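(* For every $\varepsilon>0$, the number of monic cubic polynomials $f(X)=X^3+aX^2+bX+c$ with $a,b,c\in\mathbb Z\cap[-H,H]$ which are irreducible over $\mathbb Q$ and whose Galois group over $\mathbb Q$ is not isomorphic to $S_3$ is $O_\varepsilon(H^{1.5+\varepsilon})$ as $H\to\infty$. *)

(* Defs.v *)
From HB Require Import structures.
From mathcomp Require Import all_boot all_order all_algebra all_fingroup all_field.
From mathcomp Require Import boolp reals.
From mathcomp Require Import exp.
Set Implicit Arguments. Unset Strict Implicit. Unset Printing Implicit Defensive.
Import Order.TTheory GRing.Theory Num.Theory.
Local Open Scope ring_scope.

Definition cubic (a b c : int) : {poly rat} :=
  'X^3 + (a%:~R)%:P * 'X^2 + (b%:~R)%:P * 'X + (c%:~R)%:P.

(* The Galois group over Q of f is isomorphic to S_3: for some splitting field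
   E of f (inside some field extension L of Q; all splitting fields of f over
   Q are isomorphic), the group 'Gal(E / Q) of Q-automorphisms of E is
   isomorphic to the symmetric group on 3 letters. *)
Definition galois_group_isog_S3 (f : {poly rat}) : Prop :=
  exists (L : splittingFieldType rat) (E : {subfield L}),
    splittingFieldFor 1%VS (map_poly ratr f) E /\
    ('Gal(E / 1%AS) \isog [set: {perm 'I_3}])%g.

Definition int_box (H : nat) : seq int :=
  [seq (i%:Z - H%:Z) | i <- iota 0 (2 * H).+1].

Definition count_nonS3 (H : nat) : nat :=
  count (fun t : int * int * int =>
           `[< irreducible_poly (cubic t.1.1 t.1.2 t.2) /\
               ~ galois_group_isog_S3 (cubic t.1.1 t.1.2 t.2) >])
        [seq (ab, c) | ab <- [seq (a, b) | a <- int_box H, b <- int_box H],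
                        c <- int_box H].

(* Main.v *)
(* The discriminant of a counted cubic x^3 + a x^2 + b x + c is a square y^2, so
   with i = a^2 - 3 b and j = 2 a^3 - 9 a b + 27 c one has 4 i^3 = j^2 + 27 y^2:
   the Eisenstein integer z with trace j and imaginary coordinate 3 y has norm
   i^3. Unique factorization in Z[w] gives z = w^3 m^2 (conj m), hence
   i = N(w) N(m), and (a, w, m) determines (a, b, c).
   For A <= |a| < 2 A and A^2 >= 6 H, i is of size A^2 while y = O(A H), so
   w^3 m is nearly real. For fixed w this puts m in a strip. For fixed m, two
   solutions w, w0 satisfy: v = w (conj w0) has v^3 nearly real, and the
   imaginary coordinate of v^3 is a product of three linear forms, so w lies in
   one of three strips. Always using the smaller of w, m as the fixed one gives
   O(H log H + A^(3/2)) pairs, each compatible with O(H / A) values of a. If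
   a^2 = O(H), counting the pairs with N(w) N(m) = O(H) suffices. *)

Require Import Defs.
From HB Require Import structures.
From mathcomp Require Import all_boot all_order all_algebra all_fingroup all_field.
From mathcomp Require Import boolp reals exp.
From mathcomp Require Import ring lra zify.
Import Order.TTheory GRing.Theory Num.Theory.
Local Open Scope ring_scope.

(** * Discriminants and Galois groups of cubics *)

(** The exponent 3/2 arises on multiplying the number of pairs by [H / A]: up to logarithms this
    gives [H^2 / A] and [H * A^(1/2)], both at most [H^(3/2)] in the range [H^(1/2) <= A <= H]. If
    the fixed element has size s, its strip contributes about [H / s^2] points by area and [A / s]
    by length. There are about s elements of size s, so summing up to X gives [H log X + A X]; the
    second term is what forces the fixed element to be the smaller one, of size at most about
    [A^(1/2)]. With [m] fixed, near-reality of [w^3 m] is a cubic condition on [w]; comparison with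
    one known solution linearizes it without any analysis of angles. The pair [(w, m)] is not
    unique, since units can be moved around. This is harmless for an upper bound: all that counts is
    that [i] gives back [b] and then [j] gives back [c]. The two logarithms of the final bound come
    from the harmonic sums and from the dyadic ranges of [|a|]. *)

Section GaloisPermutation.

Variables (F : fieldType) (L : splittingFieldType F) (n : nat) (r : n.-tuple L).
Variable p : {poly L}.
Hypotheses (Fp : p \is a polyOver 1%VS) (Dp : p = \prod_(x <- r) ('X - x%:P)).
Hypotheses (r_uniq : uniq r) (r_gen : <<1 & r>>%VS = {:L}%VS).

Let r_inj : injective (tnth r). Proof. exact/tuple_uniqP. Qed.

Let mem_gal1 (g : gal_of {:L}) : g \in 'Gal({:L} / 1)%g.
Proof. by rewrite gal_kHom ?sub1v // k1AHom. Qed.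

Fact gal_root_subproof (g : gal_of {:L}) i : (index (g (tnth r i)) r < n)%N.
Proof.
rewrite -[X in (_ < X)%N](size_tuple r) index_mem -root_prod_XsubC -Dp.
rewrite -(fixedPoly_gal (sub1v _) (mem_gal1 g) Fp) fmorph_root Dp.
by rewrite root_prod_XsubC mem_tnth.
Qed.

Definition gal_root_idx g i := Ordinal (gal_root_subproof g i).

Lemma tnth_gal_root g i : tnth r (gal_root_idx g i) = g (tnth r i).
Proof.
rewrite (tnth_nth 0) /= nth_index //.
by rewrite -index_mem size_tuple gal_root_subproof.
Qed.

Fact gal_root_idx_inj g : injective (gal_root_idx g).
Proof.
move=> i j eq_ij; apply: r_inj.
have: g (tnth r i) = g (tnth r j) by rewrite -!tnth_gal_root eq_ij.
exact: fmorph_inj.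
Qed.

Definition gal_root_perm g := perm (@gal_root_idx_inj g).

Fact gal_root_permM :
  {in 'Gal({:L} / 1)%g &, {morph gal_root_perm : g h / (g * h)%g}}.
Proof.
move=> g h _ _; apply/permP=> i; apply: r_inj.
by rewrite permM !permE !tnth_gal_root galM ?memvf.
Qed.

Canonical gal_root_morphism := Morphism gal_root_permM.

Fact gal_root_injm : ('injm gal_root_perm)%g.
Proof.
apply/subsetP=> g /morphpreP[_ /set1P/permP g_id]; apply/set1P/eqP/gal_eqP=> x _.
rewrite gal_id; have r_x : x \in <<1 & r>>%VS by rewrite r_gen memvf.
have : (<<1 & r>> <= fixedSpace g)%VS.
  apply/Fadjoin_seqP; split=> [|y /tnthP[i ->]]; first exact: sub1v.
  apply/fixedSpaceP; by rewrite -tnth_gal_root; have := g_id i; rewrite permE perm1 => ->.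
by move/subvP/(_ _ r_x)/fixedSpaceP.
Qed.

(** The action on the roots embeds the group in the symmetric group. Distinct roots make the
    extension Galois, so the group has order [\dim {:L}], and the lower bound leaves room only for
    the whole symmetric group. *)
Lemma gal_isog_sym : (n`! <= \dim {:L})%N ->
  ('Gal({:L} / 1) \isog [set: {perm 'I_n}])%g.
Proof.
move=> dimL; have galL : galois 1 {:L}.
  apply/splitting_galoisField; exists p; split=> //; first by rewrite Dp separable_prod_XsubC.
  by exists r; rewrite ?Dp ?eqpxx.
have := sub_isog (subxx _) gal_root_injm.
suff -> : (gal_root_perm @* 'Gal({:L} / 1))%g = [set: {perm 'I_n}] by [].
apply/eqP; rewrite eqEcard subsetT cardsT card_injm ?gal_root_injm //.
by rewrite card_Sn -(galois_dim galL) dimv1 divn1.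
Qed.

End GaloisPermutation.

Definition cubic_disc {R : pzRingType} (a b c : R) : R :=
  a ^+ 2 * b ^+ 2 - 4 * b ^+ 3 - 4 * a ^+ 3 * c - 27 * c ^+ 2 + 18 * a * b * c.

Lemma cubic_disc_int (R : comNzRingType) (a b c : int) :
  (cubic_disc a b c)%:~R = cubic_disc (a%:~R : R) b%:~R c%:~R.
Proof. by rewrite /cubic_disc; ring. Qed.

Section CubicGalois.

Variables a b c : int.
Let f := cubic a b c.

Lemma size_cubic : size f = 4%N.
Proof.
rewrite /f /cubic -!addrA size_polyDl ?size_polyXn //.
rewrite ltnS; apply: (leq_trans (size_polyD _ _)); rewrite geq_max mul_polyC.
rewrite (leq_trans (size_scale_leq _ _)) ?size_polyXn //=.
apply: (leq_trans (size_polyD _ _)); rewrite geq_max mul_polyC.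
rewrite (leq_trans (size_scale_leq _ _)) ?size_polyX //=.
by rewrite size_polyC; case: eqP.
Qed.

Lemma cubic_monic : f \is monic.
Proof.
rewrite monicE lead_coefE size_cubic /f /cubic /= !coefD !mul_polyC !coefZ.
by rewrite !coefXn coefX coefC /= !mulr0 !addr0.
Qed.

Let map_ratrE (F : fieldExtType rat) : map_poly ratr f = map_poly (in_alg F) f.
Proof. by apply: eq_map_poly => r; exact/esym/(fmorph_eq_rat (in_alg F)). Qed.

Let ratr_over1 (F : fieldExtType rat) :
  map_poly ratr f \is a polyOver (1%VS : {vspace F}).
Proof. by rewrite map_ratrE; apply/polyOver1P; exists f. Qed.

Lemma map_cubic (F : fieldExtType rat) :
  map_poly ratr f = 'X^3 + (a%:~R)%:P * 'X^2 + (b%:~R)%:P * 'X + (c%:~R)%:P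
    :> {poly F}.
Proof.
have P (z : int) : map_poly (in_alg F) (z%:~R)%:P = (z%:~R)%:P.
  by rewrite map_polyC /= -in_algE rmorph_int.
rewrite map_ratrE /f /cubic !rmorphD /= !(rmorphM _ _%:P) /=.
by rewrite !map_polyXn map_polyX !P.
Qed.

Lemma cubic_vieta (F : fieldExtType rat) (x y z : F) :
  map_poly ratr f = \prod_(t <- [:: x; y; z]) ('X - t%:P) ->
  [/\ a%:~R = - (x + y + z), b%:~R = x * y + x * z + y * z
    & c%:~R = - (x * y * z)].
Proof.
rewrite map_cubic !big_cons big_nil mulr1.
have -> : ('X - x%:P) * (('X - y%:P) * ('X - z%:P)) =
  'X^3 + (- (x + y + z))%:P * 'X^2 + (x * y + x * z + y * z)%:P * 'X
     + (- (x * y * z))%:P.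
  by rewrite !rmorphN !rmorphD /= !rmorphM /=; ring.
move/polyP=> E; split; [move: (E 2%N)|move: (E 1%N)|move: (E 0%N)].
- by rewrite !coefD !coefCM !coefXn !coefX !coefC /= !mulr0 !mulr1 !addr0 !add0r.
- by rewrite !coefD !coefCM !coefXn !coefX !coefC /= !mulr0 !mulr1 !addr0 !add0r.
by rewrite !coefD !coefCM !coefXn !coefX !coefC /= !mulr0 !add0r.
Qed.

Hypothesis f_irr : irreducible_poly f.
Hypothesis f_disc : forall r : rat, r ^+ 2 != (cubic_disc a b c)%:~R.

(** The minimal polynomial of [x] has rational coefficients, is not constant and divides the
    irreducible [f]. *)
Lemma adjoin_degree_root (F : fieldExtType rat) (x : F) :
  root (map_poly ratr f) x -> adjoin_degree 1 x = 3%N.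
Proof.
move=> fx0; apply: succn_inj; rewrite -size_minPoly.
have /polyOver1P[q Dq] := minPolyOver 1 x.
have := minPoly_dvdp (ratr_over1 F) fx0; rewrite Dq map_ratrE dvdp_map.
move=> q_dv_f; rewrite size_map_poly.
have /f_irr/(_ q_dv_f)/eqp_size-> : size q != 1%N; last exact: size_cubic.
by rewrite -(size_map_poly (in_alg F)) -Dq size_minPoly eqSS -lt0n.
Qed.

(** The dimension is divisible by 3 because of the root [x], and by 2 because of [d], a square root
    of the discriminant that [f_disc] keeps out of the rationals. Hence it is at least 6. *)
Lemma cubic_gal_isog (L : splittingFieldType rat) (x y z : L) :
  <<1 & [:: x; y; z]>>%VS = {:L}%VS ->
  map_poly ratr f = \prod_(t <- [:: x; y; z]) ('X - t%:P) ->
  ('Gal({:L} / 1) \isog [set: {perm 'I_3}])%g.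
Proof.
move=> gen Df; have [Da Db Dc] := cubic_vieta _ _ _ _ Df.
pose d : L := (x - y) * (x - z) * (y - z).
have Dd : d ^+ 2 = (cubic_disc a b c)%:~R.
  by rewrite cubic_disc_int Da Db Dc /cubic_disc /d; ring.
have d_notin : d \notin 1%VS.
  apply/negP=> /vlineP[r Dr]; have /eqP[] := f_disc r.
  have : in_alg L (r ^+ 2) = in_alg L (cubic_disc a b c)%:~R.
    by rewrite rmorphXn rmorph_int /= -Dr Dd.
  exact: fmorph_inj.
have d_neq0 : d != 0 by apply: contraNneq d_notin => ->; rewrite mem0v.
apply: (@gal_isog_sym _ L 3 [tuple x; y; z] _ (ratr_over1 L) Df) => //.
  move: d_neq0; rewrite /d !mulf_eq0 !subr_eq0 !negb_or => /andP[/andP[xy xz] yz].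
  by rewrite /= !inE negb_or xy xz yz.
have deg3 : (3 %| \dim {:L})%N.
  have := field_dimS (subvf <<1; x>>%AS); rewrite dim_Fadjoin dimv1 muln1.
  by rewrite adjoin_degree_root // Df root_prod_XsubC mem_head.
have deg2 : (2 %| \dim {:L})%N.
  have := field_dimS (subvf <<1; d>>%AS); rewrite dim_Fadjoin dimv1 muln1.
  suff -> : adjoin_degree 1 d = 2%N by [].
  apply/eqP; rewrite eqn_leq ltn_neqAle eq_sym adjoin_deg_eq1 d_notin.
  rewrite andbT -ltnS -size_minPoly -(size_XnsubC (d ^+ 2) (n := 2)) //.
  apply: dvdp_leq; first by rewrite -size_poly_gt0 size_XnsubC.
  apply: minPoly_dvdp; last by rewrite rootE !hornerE subrr.
  by rewrite rpredB ?rpredX ?polyOverX // polyOverC Dd rpred_int.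
apply: dvdn_leq; first exact: adim_gt0.
by rewrite (@Gauss_dvd 2 3) // deg2.
Qed.

(** The required splitting field is built as the number field generated by the roots of [f] in
    [algC]. *)
Lemma cubic_gal_sym : galois_group_isog_S3 f.
Proof.
have [rs] := closed_field_poly_normal (map_poly ratr f : {poly algC}).
rewrite (monicP _) ?map_monic ?cubic_monic // scale1r => Drs.
have [Qs [QsC [s1 Ds1 gen]]] := num_field_exists rs.
have Df : map_poly ratr f = \prod_(x <- s1) ('X - x%:P) :> {poly Qs}.
  apply: (map_poly_inj QsC); rewrite map_ratrE -map_poly_comp rmorph_prod /=.
  rewrite (eq_map_poly (fmorph_eq_rat (QsC \o in_alg Qs))) Drs -Ds1 big_map.
  by apply: eq_bigr => x _; rewrite rmorphB /= map_polyX map_polyC.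
have sz_s1 : size s1 = 3%N.
  apply: succn_inj.
  by rewrite -(size_prod_XsubC s1 id) -Df map_ratrE size_map_poly size_cubic.
have splitQs : splittingFieldFor 1 (map_poly ratr f) {:Qs}.
  by exists s1; rewrite ?Df ?eqpxx.
have QsP : SplittingField.axiom Qs.
  by exists (map_poly ratr f); [exact: ratr_over1 | exact: splitQs].
pose L : splittingFieldType rat :=
  HB.pack Qs (FieldExt_isSplittingField.Build rat Qs QsP).
exists L, {:L}%AS; split=> //.
case: s1 => [|x [|y [|z []]]] // in Ds1 gen Df sz_s1 splitQs *.
exact: (@cubic_gal_isog L x y z gen Df).
Qed.

End CubicGalois.

(** A rational root of the monic [X^2 - n] is an algebraic integer, hence an integer. *)
Lemma rat_sqr_int (r : rat) (n : int) : r ^+ 2 = n%:~R -> exists m : int, m ^+ 2 = n.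
Proof.
move=> Er; have Ar : (ratr r : algC) \in Aint.
  apply: (@root_monic_Aint ('X^2 - (n%:~R)%:P)).
  - by rewrite rootE !hornerE -rmorphXn /= Er rmorph_int subrr.
  - exact: monicXnsubC.
  apply/polyOverP=> i; rewrite coefB coefXn coefC rpredB //.
    exact: rpred_nat.
  by case: eqP => _; [exact: rpred_int | exact: rpred0].
have /intrP[m Dm] := Cint_rat_Aint (Crat_rat r) Ar.
exists m; apply: (@intr_inj rat); rewrite rmorphXn /= -Er; congr (_ ^+ 2).
have : ratr m%:~R = ratr r :> algC by rewrite ratr_int.
exact: fmorph_inj.
Qed.

Lemma nonS3_disc_square (a b c : int) :
  irreducible_poly (cubic a b c) -> ~ galois_group_isog_S3 (cubic a b c) ->
  exists y : int, y ^+ 2 = cubic_disc a b c.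
Proof.
move=> f_irr nS3; case: (pselect (exists r : rat, r ^+ 2 = (cubic_disc a b c)%:~R)).
  by case=> r /rat_sqr_int.
move=> nsq; case: nS3; apply: cubic_gal_sym => // r.
by apply/eqP=> Er; apply: nsq; exists r.
Qed.

(** * Eisenstein integers *)

(* [(x, y)] stands for [x + y w], where [w] is a primitive cube root of unity. *)
Definition eis : Type := (int * int)%type.
HB.instance Definition _ := GRing.Zmodule.copy eis (int * int)%type.

Definition eis_mul (z w : eis) : eis :=
  (z.1 * w.1 - z.2 * w.2, z.1 * w.2 + z.2 * w.1 - z.2 * w.2).

Lemma eisP (z w : eis) : z.1 = w.1 -> z.2 = w.2 -> z = w.
Proof. by case: z w => [? ?] [? ?] /= -> ->. Qed.

Fact eis_mulA : associative eis_mul.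
Proof. by move=> x y z; apply: eisP; rewrite /eis_mul /=; ring. Qed.
Fact eis_mulC : commutative eis_mul.
Proof. by move=> x y; apply: eisP; rewrite /eis_mul /=; ring. Qed.
Fact eis_mul1 : left_id (1, 0) eis_mul.
Proof. by move=> x; apply: eisP; rewrite /eis_mul /=; ring. Qed.
Fact eis_mulDl : left_distributive eis_mul +%R.
Proof. by move=> x y z; apply: eisP; rewrite /eis_mul /=; ring. Qed.

HB.instance Definition _ := GRing.Zmodule_isComNzRing.Build eis
  eis_mulA eis_mulC eis_mul1 eis_mulDl (isT : ((1, 0) : eis) != 0).

Lemma eis_mulE (z w : eis) :
  ((z * w).1 = z.1 * w.1 - z.2 * w.2)
  * ((z * w).2 = z.1 * w.2 + z.2 * w.1 - z.2 * w.2).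
Proof. by []. Qed.
Lemma eis_addE (z w : eis) : ((z + w).1 = z.1 + w.1) * ((z + w).2 = z.2 + w.2).
Proof. by []. Qed.
Lemma eis_oppE (z : eis) : ((- z).1 = - z.1) * ((- z).2 = - z.2).
Proof. by []. Qed.
Lemma eis_1E : ((1 : eis).1 = 1) * ((1 : eis).2 = 0).
Proof. by []. Qed.
Definition eisE := (eis_mulE, eis_addE, eis_oppE, eis_1E).

Definition eis_int (n : int) : eis := (n, 0).
(** Conjugation sends [w] to [w^2 = -1 - w]. *)
Definition eis_conj (z : eis) : eis := (z.1 - z.2, - z.2).
Definition eis_norm (z : eis) : int := z.1 ^+ 2 - z.1 * z.2 + z.2 ^+ 2.

Lemma eis_conjK : involutive eis_conj.
Proof. by move=> z; apply: eisP; rewrite /eis_conj /=; ring. Qed.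
Lemma eis_conjM z w : eis_conj (z * w) = eis_conj z * eis_conj w.
Proof. by apply: eisP; rewrite /eis_conj /= ?eisE /=; ring. Qed.
Lemma eis_normM z w : eis_norm (z * w) = eis_norm z * eis_norm w.
Proof. by rewrite /eis_norm !eisE; ring. Qed.
Lemma eis_norm_conj z : eis_norm (eis_conj z) = eis_norm z.
Proof. by rewrite /eis_norm /eis_conj /=; ring. Qed.
Lemma eis_mul_conj z : z * eis_conj z = eis_int (eis_norm z).
Proof. by apply: eisP; rewrite !eisE /eis_norm /=; ring. Qed.
Lemma eis_intM m n : eis_int (m * n) = eis_int m * eis_int n.
Proof. by apply: eisP; rewrite !eisE /=; ring. Qed.

Lemma eis_norm_ge0 z : 0 <= eis_norm z.
Proof.
rewrite /eis_norm; have := sqr_ge0 (2 * z.1 - z.2); have := sqr_ge0 z.2.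
by move: z.1 z.2 => x y; lia.
Qed.

Lemma eis_norm_eq0 z : (eis_norm z == 0) = (z == 0).
Proof.
apply/eqP/eqP=> [|-> //]; case: z => [x y]; rewrite /eis_norm /= => E.
have := sqr_ge0 (2 * x - y); have := sqr_ge0 y => y2 xy2.
have y0 : y = 0 by apply/eqP; rewrite -sqrf_eq0; apply/eqP; lia.
by move: E; rewrite y0 => E; apply: eisP => //=; nia.
Qed.

Lemma eis_norm_gt0 z : (0 < eis_norm z) = (z != 0).
Proof. by rewrite lt_def eis_norm_ge0 andbT eis_norm_eq0. Qed.

Lemma eis_mulf_eq0 (z w : eis) : (z * w == 0) = (z == 0) || (w == 0).
Proof. by rewrite -!eis_norm_eq0 eis_normM mulf_eq0. Qed.

Lemma eis_mulfI (z : eis) : z != 0 -> injective ( *%R z).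
Proof.
move=> z0 x y /eqP; rewrite -subr_eq0 -mulrBr eis_mulf_eq0 (negPf z0) subr_eq0.
by move/eqP.
Qed.

(** Round both coordinates of [z * eis_conj w / n] to nearest integers. The errors are at most 1/2,
    so the norm of the error is at most 3/4. *)
Lemma eis_euclid (z w : eis) : w != 0 -> exists q, eis_norm (z - q * w) < eis_norm w.
Proof.
rewrite -eis_norm_gt0; set n := eis_norm w => n_gt0.
pose round t := ((2 * t + n) %/ (2 * n))%Z.
have roundP t : - n <= 2 * (t - round t * n) <= n.
  rewrite /round; have := divz_eq (2 * t + n) (2 * n).
  have : 0 <= ((2 * t + n) %% (2 * n))%Z < 2 * n.
    by rewrite modz_ge0 ?ltz_pmod //; lia.
  by move: (_ %/ _)%Z (_ %% _)%Z => q r; nia.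
pose t : eis := z * eis_conj w; pose q : eis := (round t.1, round t.2).
exists q; rewrite -(ltr_pM2r n_gt0).
have -> : eis_norm (z - q * w) * n = eis_norm (t.1 - round t.1 * n, t.2 - round t.2 * n).
  rewrite /n -[X in _ * X]eis_norm_conj -eis_normM; congr eis_norm.
  by apply: eisP; rewrite /t /n /eis_norm !eisE /=; ring.
rewrite /eis_norm /=; move: (roundP t.1) (roundP t.2).
move: (t.1 - _) (t.2 - _) => x y; nra.
Qed.

Definition eis_dvd (d z : eis) : Prop := exists q, z = q * d.

Lemma eis_dvd_trans d e z : eis_dvd d e -> eis_dvd e z -> eis_dvd d z.
Proof. by case=> q -> [r ->]; exists (r * q); rewrite mulrA. Qed.
Lemma eis_dvd_mull d x y : eis_dvd d x -> eis_dvd d (y * x).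
Proof. by case=> q ->; exists (y * q); rewrite mulrA. Qed.
Lemma eis_dvdD d x y : eis_dvd d x -> eis_dvd d y -> eis_dvd d (x + y).
Proof. by case=> q -> [r ->]; exists (q + r); rewrite mulrDl. Qed.
Lemma eis_dvd_conj d x : eis_dvd d x -> eis_dvd (eis_conj d) (eis_conj x).
Proof. by case=> q ->; exists (eis_conj q); rewrite eis_conjM. Qed.

Lemma eis_min_norm (P : eis -> Prop) :
  (exists z, P z) -> exists2 z, P z & forall y, P y -> eis_norm z <= eis_norm y.
Proof.
case=> z; have [n] := ubnP `|eis_norm z|%N; elim: n z => // n IH z le_n Pz.
have [[y Py lt_yz]|min_z] := pselect (exists2 y, P y & eis_norm y < eis_norm z).
  apply: (IH y) => //; have := eis_norm_ge0 y; have := eis_norm_ge0 z; lia.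
exists z => // y Py; rewrite leNgt; apply/negP=> lt_yz; apply: min_z.
by exists y.
Qed.

(** * Primes of Z[w] and elements whose norm is a cube *)

Definition eis_prime (p : eis) : Prop :=
  1 < eis_norm p /\ forall x y, eis_dvd p (x * y) -> eis_dvd p x \/ eis_dvd p y.

(** A nonzero combination of least norm divides every combination, by division with remainder. *)
Lemma eis_gcd (x y : eis) : x != 0 ->
  exists g, [/\ eis_dvd g x, eis_dvd g y & exists a b, g = a * x + b * y].
Proof.
move=> x0; pose P g := g != 0 /\ exists a b, g = a * x + b * y.
have [|g [g0 [a [b Dg]]] g_min] := @eis_min_norm P.
  by exists x; split=> //; exists 1, 0; rewrite mul1r mul0r addr0.
have dvdg u v : eis_dvd g (u * x + v * y).
  have [q lt_q] := eis_euclid (u * x + v * y) _ g0; exists q; apply/eqP.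
  rewrite -subr_eq0; apply: contraT => r0; move: lt_q; rewrite ltNge.
  move/negP; case; apply: g_min; split=> //.
  by exists (u - q * a), (v - q * b); rewrite Dg; ring.
exists g; split; last by exists a, b.
  by have := dvdg 1 0; rewrite mul1r mul0r addr0.
by have := dvdg 0 1; rewrite mul1r mul0r add0r.
Qed.

(** Take a divisor [p] of least norm above 1. Its gcd with [x] is either a unit, and then Bezout
    gives [p] dividing [y], or, by minimality, an associate of [p]. *)
Lemma eis_prime_exists z : 1 < eis_norm z -> exists2 p, eis_prime p & eis_dvd p z.
Proof.
move=> z_gt1; pose P d := 1 < eis_norm d /\ eis_dvd d z.
have [|p [p_gt1 p_z] p_min] := @eis_min_norm P.
  by exists z; split=> //; exists 1; rewrite mul1r.
exists p => //; split=> // x y p_xy.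
have [|g [[q Dp] g_x [a [b Dg]]]] := @eis_gcd p x.
  by rewrite -eis_norm_gt0; lia.
have Np : eis_norm p = eis_norm q * eis_norm g by rewrite Dp eis_normM.
have [g1|g_neq1] := eqVneq (eis_norm g) 1.
  right; have -> : y = eis_conj g * ((a * y) * p + b * (x * y)).
    have -> : a * y * p + b * (x * y) = g * y by rewrite Dg; ring.
    by rewrite mulrA [_ * g]mulrC eis_mul_conj g1 mul1r.
  by apply/eis_dvd_mull/eis_dvdD; apply: eis_dvd_mull => //; exists 1; rewrite mul1r.
have g_gt1 : 1 < eis_norm g by have := eis_norm_ge0 q; have := eis_norm_ge0 g; nia.
have q1 : eis_norm q = 1.
  have : eis_norm p <= eis_norm g.
    by apply: p_min; split=> //; apply: eis_dvd_trans p_z; exists q.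
  by have := eis_norm_ge0 q; nia.
left; apply: eis_dvd_trans g_x; exists (eis_conj q).
by rewrite Dp mulrA [_ * q]mulrC eis_mul_conj q1 mul1r.
Qed.

Lemma eis_prime_conj p : eis_prime p -> eis_prime (eis_conj p).
Proof.
case=> p_gt1 pP; split=> [|x y]; first by rewrite eis_norm_conj.
move/eis_dvd_conj; rewrite eis_conjK eis_conjM => /pP[]/eis_dvd_conj.
  by rewrite eis_conjK; left.
by rewrite eis_conjK; right.
Qed.

Fact mulz_gt1_neq1 (m n : int) : 0 <= m -> 1 < n -> m * n <> 1.
Proof. by move=> m_ge0 n_gt1 E; have := ler_peMl m_ge0 (ltW n_gt1); case: (ltrgtP m 0) m_ge0; nia. Qed.

(** A prime [p] dividing [z] divides [n], so [p ^+ 3] divides [z * eis_conj z]; the cases follow how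
    its three factors are shared between [z] and its conjugate. The witness is [p] or its conjugate,
    and only its norm matters to the descent that follows. *)
Lemma eis_prime_cube_dvd z n : 1 < eis_norm z -> eis_norm z = n ^+ 3 ->
  exists2 p, 1 < eis_norm p &
    eis_dvd (p ^+ 3) z \/ eis_dvd (p ^+ 2 * eis_conj p) z.
Proof.
move=> z_gt1 Nz; have [p p_prime [z1 Dz]] := eis_prime_exists _ z_gt1.
have [p_gt1 pP] := p_prime; have [_ cP] := eis_prime_conj _ p_prime.
have p0 : p != 0 by rewrite -eis_norm_gt0; lia.
have [n' Dn] : eis_dvd p (eis_int n).
  have : eis_dvd p (eis_int n * (eis_int n * eis_int n)).
    by rewrite -!eis_intM -expr2 -exprS -Nz -eis_mul_conj Dz; exists (z1 * eis_conj (z1 * p)); ring.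
  by case/pP=> // /pP[].
have E1 : z1 * eis_conj z = p * (p * n' ^+ 3).
  apply: (eis_mulfI _ p0); rewrite mulrA [p * z1]mulrC -Dz eis_mul_conj Nz.
  by rewrite !exprS expr0 mulr1 !eis_intM Dn; ring.
have [[z2 Dz1]|not_p_z1] := pselect (eis_dvd p z1).
  have E2 : z2 * eis_conj z = p * n' ^+ 3.
    by apply: (eis_mulfI _ p0); rewrite -E1 Dz1; ring.
  exists p => //; have [|[z3 Dz2]|[y Dzc]] := pP z2 (eis_conj z).
  - by rewrite E2; exists (n' ^+ 3); rewrite mulrC.
  - by left; exists z3; rewrite Dz Dz1 Dz2; ring.
  have /cP[|c_pp] : eis_dvd (eis_conj p) (z2 * (p * p)).
  - exists (eis_conj y); rewrite -eis_conjM -Dzc eis_conjK Dz Dz1; ring.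
  - by case=> z3 Dz2; right; exists z3; rewrite Dz Dz1 Dz2; ring.
  (* Here [p] is an associate of its conjugate. Then [p ^+ 4] divides [n ^+ 3], which forces
     [p ^+ 2] to divide [n]; so [p ^+ 6] divides the norm of [z], and a further [p] sits in [z2] or
     in its conjugate. *)
  have [u Dp] : eis_dvd p (eis_conj p).
    by case/cP: c_pp => /eis_dvd_conj; rewrite eis_conjK.
  have Nu : eis_norm u = 1.
    have := eis_normM u p; rewrite -Dp eis_norm_conj; nia.
  have Dy : y = u ^+ 2 * p * eis_conj z2.
    by apply: (eis_mulfI _ p0); rewrite mulrC -Dzc Dz Dz1 !eis_conjM Dp; ring.
  have E3 : z2 * y = n' ^+ 3.
    by apply: (eis_mulfI _ p0); rewrite -E2 Dzc; ring.
  have [m Dn'] : eis_dvd p n'.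
    have : eis_dvd p (n' * (n' * n')).
      by exists (z2 * u ^+ 2 * eis_conj z2); rewrite -expr2 -exprS -E3 Dy; ring.
    by case/pP=> // /pP[].
  have : eis_dvd p (z2 * (eis_conj z2 * u ^+ 2)).
    exists (p * m ^+ 3); apply: (eis_mulfI _ p0).
    transitivity (z2 * y); first by rewrite Dy; ring.
    by rewrite E3 Dn'; ring.
  case/pP=> [[v Dz2]|/pP[/eis_dvd_conj|[v Dv]]].
  - by left; exists v; rewrite Dz Dz1 Dz2; ring.
  - by rewrite eis_conjK => -[v Dz2]; right; exists v; rewrite Dz Dz1 Dz2; ring.
  have := eis_normM v p; rewrite -Dv expr2 eis_normM Nu mul1r => /esym.
  by move/(mulz_gt1_neq1 _ _ (eis_norm_ge0 v) p_gt1).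
(* Now [p] divides [z] exactly once, so two factors [p] lie in the conjugate of [z], and [z]
   contains [eis_conj p ^+ 2]. *)
have [y Dzc] : eis_dvd p (eis_conj z).
  have : eis_dvd p (z1 * eis_conj z) by rewrite E1; exists (p * n' ^+ 3); ring.
  by case/pP.
have [y' Dy] : eis_dvd p y.
  have : eis_dvd p (z1 * y).
    by exists (n' ^+ 3); apply: (eis_mulfI _ p0); transitivity (z1 * eis_conj z);
      [rewrite Dzc; ring | rewrite E1; ring].
  by case/pP.
have Dz' : z = eis_conj y' * eis_conj p ^+ 2.
  by rewrite -[LHS]eis_conjK Dzc Dy !eis_conjM; ring.
have : eis_dvd p (eis_conj y' * (eis_conj p * eis_conj p)).
  by exists z1; rewrite -expr2 -Dz' Dz.
case/pP=> [[v Dv]|].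
  exists (eis_conj p); first by rewrite eis_norm_conj.
  by right; exists v; rewrite eis_conjK Dz' Dv; ring.
move=> c_pp; have [u Du] : eis_dvd p (eis_conj p) by case/pP: c_pp.
case: not_p_z1; exists (eis_conj y' * u ^+ 2); apply: (eis_mulfI _ p0).
by rewrite mulrC -Dz Dz' Du; ring.
Qed.

(* The witnesses record the Kummer structure of a cyclic cubic field: up to
   cubes, a Lagrange resolvent cubed is [m ^ 2 * m bar]. *)
Lemma eis_cubic_norm z n : z != 0 -> eis_norm z = n ^+ 3 ->
  exists w m, z = w ^+ 3 * (m ^+ 2 * eis_conj m).
Proof.
have [k] := ubnP `|eis_norm z|%N; elim: k z n => // k IH z n le_k z0 Nz.
have Nz_gt0 : 0 < eis_norm z by rewrite eis_norm_gt0.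
have [Nz1|Nz_neq1] := eqVneq (eis_norm z) 1.
  (* For a unit [z], [z ^+ 2 * eis_conj z] is [z] itself. *)
  by exists 1, z; rewrite expr1n mul1r expr2 -mulrA eis_mul_conj Nz1 mulr1.
have [|p p_gt1 dvd_z] := eis_prime_cube_dvd z n _ Nz; first by lia.
have [q [z' [Dz Nq]]] : exists q z', z = z' * q /\ eis_norm q = eis_norm p ^+ 3 /\
   (q = p ^+ 3 \/ q = p ^+ 2 * eis_conj p).
  case: dvd_z => -[z' Dz]; [exists (p ^+ 3) | exists (p ^+ 2 * eis_conj p)];
    exists z'; split=> //; split; try by [left | right].
  - by rewrite !exprS expr0 !mulr1 !eis_normM.
  - by rewrite !exprS expr0 !mulr1 !eis_normM eis_norm_conj; ring.
case: Nq => Nq Dq; have z'0 : z' != 0.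
  by apply: contra z0 => /eqP z'0; rewrite Dz z'0 mul0r.
have Nz' : 0 < eis_norm z' by rewrite eis_norm_gt0.
have Nzz : eis_norm z = eis_norm z' * eis_norm p ^+ 3 by rewrite Dz eis_normM Nq.
have [n' Dn] : exists n', n = n' * eis_norm p.
  suff : (eis_norm p %| n)%Z by case/dvdzP=> n' ->; exists n'.
  rewrite dvdzE -(@dvdn_pexp2r _ _ 3) // -!abszX -Nz Nzz abszM dvdn_mull //.
have [|//||w [m Dz']] := IH z' n'.
- by move: le_k; rewrite Nzz; nia.
- apply: (@mulIf _ (eis_norm p ^+ 3)); first by rewrite expf_neq0 //; lia.
  by rewrite -Nzz Nz Dn exprMn.
(* A factor [p ^+ 3] is absorbed by [w], a factor [p ^+ 2 * eis_conj p] by [m]. *)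
case: Dq => Dq; [exists (w * p), m | exists w, (m * p)]; rewrite Dz Dz' Dq.
  by ring.
by rewrite eis_conjM; ring.
Qed.

(** * Sizes of Eisenstein integers and of linear forms in them *)

Definition eis_sup (z : eis) : nat := maxn `|z.1| `|z.2|.

Lemma eis_sup_gt0 z : (0 < eis_sup z)%N = (z != 0).
Proof.
rewrite /eis_sup; apply/idP/idP=> [|z0]; first by apply: contraTneq => ->.
rewrite lt0n; apply: contraNneq z0 => E; apply/eqP; apply: eisP => /=; lia.
Qed.

Fact normz_sqr (x : int) : `|x| ^+ 2 = x ^+ 2.
Proof. exact/real_normK/num_real. Qed.

(** Lets the sup norm, whose level sets are easy to count, stand for the square root of the norm. *)
Lemma eis_norm_sup z :
  3 * (eis_sup z)%:Z ^+ 2 <= 4 * eis_norm z /\ eis_norm z <= 3 * (eis_sup z)%:Z ^+ 2.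
Proof.
case: z => x y; rewrite /eis_sup /eis_norm /=.
have := sqr_ge0 (2 * x - y); have := sqr_ge0 (2 * y - x).
have := sqr_ge0 (x + y); have := sqr_ge0 x; have := sqr_ge0 y.
have [le_xy|lt_yx] := leqP `|x| `|y|.
- have -> : (`|y|%N : int) ^+ 2 = y ^+ 2 by rewrite abszE normz_sqr.
  have : x ^+ 2 <= y ^+ 2 by rewrite -[leLHS]normz_sqr -[leRHS]normz_sqr lerXn2r //; lia.
  by split; lia.
have -> : (`|x|%N : int) ^+ 2 = x ^+ 2 by rewrite abszE normz_sqr.
have : y ^+ 2 <= x ^+ 2 by rewrite -[leLHS]normz_sqr -[leRHS]normz_sqr lerXn2r //; lia.
by split; lia.
Qed.

(** If [k |x|] and [k |y|] were both below [b], the three terms would add up to less than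
    [3 * b ^+ 2]. This supplies the large coefficient that makes a strip thin. *)
Lemma quad_coef_large (x y n b k : int) :
  n <= x ^+ 2 + `|x * y| + y ^+ 2 -> 3 * b ^+ 2 <= k ^+ 2 * n -> 0 <= k ->
  b <= k * `|x| \/ b <= k * `|y|.
Proof.
move=> le_n le_b k0.
have [|x_lt] := leP b (k * `|x|); first by left.
have [|y_lt] := leP b (k * `|y|); first by right.
have X0 : 0 <= k * `|x| by rewrite mulr_ge0.
have Y0 : 0 <= k * `|y| by rewrite mulr_ge0.
have : k ^+ 2 * n <= (k * `|x|) ^+ 2 + (k * `|x|) * (k * `|y|) + (k * `|y|) ^+ 2.
  apply: le_trans (ler_wpM2l (sqr_ge0 k) le_n) _.
  rewrite -[x ^+ 2]normz_sqr -[y ^+ 2]normz_sqr normrM.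
  by rewrite le_eqVlt; apply/orP; left; apply/eqP; ring.
move: (k * `|x|) (k * `|y|) x_lt y_lt X0 Y0 => X Y x_lt y_lt X0 Y0 le_kn.
have XX : X ^+ 2 < b ^+ 2 by rewrite ltrXn2r //; lia.
have YY : Y ^+ 2 < b ^+ 2 by rewrite ltrXn2r //; lia.
have XY : X * Y <= b ^+ 2 by rewrite expr2 ler_pM //; lia.
by exfalso; lia.
Qed.

(** The three pairs of arguments are the coefficients of [v.1], [v.2] and [v.1 - v.2] as linear
    forms in [w], for [v = w * z]. *)
Lemma eis_norm_forms (z : eis) (d := z.1 - z.2) :
  [/\ eis_norm z <= z.1 ^+ 2 + `|z.1 * - z.2| + (- z.2) ^+ 2,
      eis_norm z <= z.2 ^+ 2 + `|z.2 * d| + d ^+ 2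
    & eis_norm z <= d ^+ 2 + `|d * - z.1| + (- z.1) ^+ 2].
Proof.
rewrite /d /eis_norm; split; [have := ler_norm (z.1 * - z.2)
  | have := ler_norm (z.2 * (z.1 - z.2))
  | have := ler_norm ((z.1 - z.2) * - z.1)]; move: z.1 z.2 => x y; lia.
Qed.

(** The norm is the square of any one of the three forms plus or minus the product of the other two.
    For the smallest form, that product is therefore at least half the norm. *)
Lemma eis_min_form (v : eis) :
  [\/ `|v.1| * eis_norm v <= 2 * `|v.1 * v.2 * (v.1 - v.2)|,
      `|v.2| * eis_norm v <= 2 * `|v.1 * v.2 * (v.1 - v.2)|
    | `|v.1 - v.2| * eis_norm v <= 2 * `|v.1 * v.2 * (v.1 - v.2)| ].
Proof.
case: v => x y; rewrite /eis_norm /=.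
have key (a b c n : int) : `|a| <= `|b| -> `|a| <= `|c| -> n <= `|b * c| + a ^+ 2 ->
    `|a| * n <= 2 * `|a * (b * c)|.
  move=> ab ac le_n; rewrite [in leRHS]normrM mulrCA ler_wpM2l //.
  have : a ^+ 2 <= `|b * c| by rewrite -normz_sqr normrM expr2 ler_pM.
  by lia.
have [xy|yx] := leP `|x| `|y|; have [xd|dx] := leP `|x| `|x - y|.
- constructor 1; rewrite -mulrA; apply: key => //; have := ler_norm (- (y * (x - y))).
  by rewrite normrN; lia.
- constructor 3; rewrite [x * y * _]mulrC; apply: key; [by lia | by lia | ].
  by have := ler_norm (x * y); have := ler_norm (- (x * y)); rewrite normrN; lia.
- constructor 2; rewrite [x * y]mulrC -mulrA; apply: key; [by lia | by lia | ].
  by have := ler_norm (x * (x - y)); lia.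
have [yd|dy] := leP `|y| `|x - y|.
- constructor 2; rewrite [x * y]mulrC -mulrA; apply: key; [by lia | by lia | ].
  by have := ler_norm (x * (x - y)); lia.
constructor 3; rewrite [x * y * _]mulrC; apply: key; [by lia | by lia | ].
by have := ler_norm (x * y); have := ler_norm (- (x * y)); rewrite normrN; lia.
Qed.

Lemma eis_sup_mul w m n : eis_norm w * eis_norm m <= n ->
  9 * ((eis_sup w)%:Z * (eis_sup m)%:Z) ^+ 2 <= 16 * n.
Proof.
move=> le_n; have [w_lo _] := eis_norm_sup w; have [m_lo _] := eis_norm_sup m.
have : (3 * (eis_sup w)%:Z ^+ 2) * (3 * (eis_sup m)%:Z ^+ 2)
    <= (4 * eis_norm w) * (4 * eis_norm m) by rewrite ler_pM // mulr_ge0 ?sqr_ge0.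
by rewrite exprMn; lia.
Qed.

(* [w] and [m] parametrize a cubic [x^3 + a x^2 + b x + c] with [|a|] of size
   [A] and [|b|, |c| <= H]; the last bound says that [w ^ 3 * m] is nearly real. *)
Definition sector_pair (H A : nat) (w m : eis) : Prop :=
  [/\ A%:Z ^+ 2 <= 2 * (eis_norm w * eis_norm m),
      eis_norm w * eis_norm m <= 5 * A%:Z ^+ 2
    & eis_norm m * `|(w ^+ 3 * m).2| <= 27 * A%:Z * H%:Z].

Lemma sector_pair_sup H A w m : sector_pair H A w m ->
  (eis_sup w * eis_sup m <= 3 * A)%N.
Proof.
case=> _ /eis_sup_mul le_n _; rewrite -leq_sqr.
by move: le_n; rewrite -PoszM; move: (_ * _)%N => k; lia.
Qed.

Lemma eis_norm_cube z : eis_norm (z ^+ 3) = eis_norm z ^+ 3.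
Proof. by rewrite !exprS expr0 !mulr1 !eis_normM. Qed.

(** The norm of [m] is at least [A^2 / (6 s^2)]; dividing the sector bound by it gives
    [162 = 27 * 6]. *)
Lemma sector_pair_left_int H A w m (s := (eis_sup w)%:Z) : (0 < A)%N ->
  sector_pair H A w m -> `|(w ^+ 3 * m).2| * A%:Z <= 162 * H%:Z * s ^+ 2.
Proof.
move=> A0 [lo _]; have [_ w_hi] := eis_norm_sup w.
move: `|_.2| (normr_ge0 (w ^+ 3 * m).2) (eis_norm_ge0 m) lo w_hi.
rewrite -/s; move: (eis_norm w) (eis_norm m) => n t y y0 t0 lo w_hi hi.
have A0' : 0 < A%:Z by [].
rewrite -(ler_pM2r A0').
have h1 : A%:Z ^+ 2 <= 6 * s ^+ 2 * t.
  by apply: le_trans lo _; have := ler_wpM2r t0 w_hi; lia.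
have h2 := ler_wpM2l y0 h1.
have h3 := ler_wpM2l (mulr_ge0 (isT : 0 <= 6 :> int) (sqr_ge0 s)) hi.
by lia.
Qed.

(** [z.2] and [z.1 - z.2] are the coefficients of [(z * m).2] as a linear form in [m]; one of them
    has the order of [|z|], that is of [s ^+ 3]. *)
Lemma sector_pair_left_coef w (s := (eis_sup w)%:Z) (z := w ^+ 3) :
  3 * s ^+ 3 <= 8 * `|z.2| \/ 3 * s ^+ 3 <= 8 * `|z.1 - z.2|.
Proof.
apply: (@quad_coef_large _ _ (eis_norm z)) => //.
  have := ler_norm (z.2 * (z.1 - z.2)); rewrite /eis_norm; lia.
rewrite /z eis_norm_cube; have [lo _] := eis_norm_sup w; rewrite -/s in lo.
have : (3 * s ^+ 2) ^+ 3 <= (4 * eis_norm w) ^+ 3.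
  by rewrite lerXn2r // ?nnegrE ?mulr_ge0 ?sqr_ge0 ?eis_norm_ge0.
by lia.
Qed.

Lemma sector_pair_coord H A w m (p := w ^+ 3 * m) : sector_pair H A w m ->
  eis_norm m * `|p.1| <= 13 * A%:Z ^+ 3.
Proof.
case=> _ hi _; have t0 := eis_norm_ge0 m.
rewrite -(@ler_pXn2r _ 2) ?nnegrE ?mulr_ge0 ?exprn_ge0 // exprMn normz_sqr.
have h1 : 3 * p.1 ^+ 2 <= 4 * eis_norm p.
  by rewrite /eis_norm; have := sqr_ge0 (p.1 - 2 * p.2); lia.
have Np : eis_norm m ^+ 2 * eis_norm p = (eis_norm w * eis_norm m) ^+ 3.
  by rewrite eis_normM eis_norm_cube; ring.
have h2 : (eis_norm w * eis_norm m) ^+ 3 <= (5 * A%:Z ^+ 2) ^+ 3.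
  by rewrite lerXn2r // ?nnegrE ?mulr_ge0 ?eis_norm_ge0 ?sqr_ge0.
have h3 := ler_wpM2l (sqr_ge0 (eis_norm m)) h1.
have h4 := exprn_ge0 6 (ler0n int A).
by move: Np h2 h3 h4; rewrite natz; lia.
Qed.

(* For two points [w, w0] of the same thin sector, [v = w * conj w0] is nearly
   real up to a cube root of unity, and the second coordinate of [v ^ 3] splits
   into the three linear forms [v.1], [v.2], [v.1 - v.2]. *)
Lemma sector_pair_right_int H A w w0 m (v := w * eis_conj w0) : (0 < A)%N ->
  sector_pair H A w m -> sector_pair H A w0 m ->
  [\/ eis_norm m * `|v.1| <= 1872 * H%:Z, eis_norm m * `|v.2| <= 1872 * H%:Z
    | eis_norm m * `|v.1 - v.2| <= 1872 * H%:Z].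
Proof.
move=> A0 wP w0P; have p_le := sector_pair_coord _ _ _ _ wP.
have p0_le := sector_pair_coord _ _ _ _ w0P.
case: wP => lo hi q_le; case: w0P => lo0 hi0 q0_le.
pose p := w ^+ 3 * m; pose p0 := w0 ^+ 3 * m; set t := eis_norm m in lo lo0 hi hi0 p_le p0_le q_le q0_le *.
have t0 : 0 <= t by apply: eis_norm_ge0.
have E : t * (3 * (v.1 * v.2 * (v.1 - v.2))) = p.2 * p0.1 - p.1 * p0.2.
  transitivity (p * eis_conj p0).2; last by rewrite eisE /=; ring.
  have -> : p * eis_conj p0 = v ^+ 3 * eis_int t.
    by rewrite /t -eis_mul_conj /p /p0 /v !exprS expr0 !mulr1 !eis_conjM; ring.
  by rewrite !exprS expr0 !mulr1 !eisE /=; ring.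
have Nv : A%:Z ^+ 4 <= 4 * t ^+ 2 * eis_norm v.
  rewrite /v eis_normM eis_norm_conj.
  have : A%:Z ^+ 2 * A%:Z ^+ 2 <= 2 * (eis_norm w * t) * (2 * (eis_norm w0 * t)).
    by rewrite ler_pM ?sqr_ge0.
  by lia.
have F : t ^+ 3 * `|v.1 * v.2 * (v.1 - v.2)| <= 234 * A%:Z ^+ 4 * H%:Z.
  have : t ^+ 2 * `|t * (3 * (v.1 * v.2 * (v.1 - v.2)))| <= 702 * A%:Z ^+ 4 * H%:Z.
    rewrite E; apply: le_trans (ler_wpM2l (sqr_ge0 t) (ler_normB _ _)) _.
    rewrite !normrM.
    have h1 : (t * `|p.2|) * (t * `|p0.1|) <= (27 * A%:Z * H%:Z) * (13 * A%:Z ^+ 3).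
      by rewrite ler_pM ?mulr_ge0.
    have h2 : (t * `|p.1|) * (t * `|p0.2|) <= (13 * A%:Z ^+ 3) * (27 * A%:Z * H%:Z).
      by rewrite ler_pM ?mulr_ge0.
    by lia.
  by rewrite normrM (ger0_norm t0) normrM (ger0_norm (isT : 0 <= 3 :> int)); lia.
(* Combining [Nv], [F] and the bound at the smallest form gives [1872 = 4 * 2 * 234]. *)
have fin x : 0 <= x -> x * eis_norm v <= 2 * `|v.1 * v.2 * (v.1 - v.2)| ->
    t * x <= 1872 * H%:Z.
  move=> x0 x_le; have A4 : 0 < A%:Z ^+ 4 by rewrite exprn_gt0.
  rewrite -(ler_pM2r A4).
  have h1 := ler_wpM2l (mulr_ge0 t0 x0) Nv.
  have h2 := ler_wpM2l (exprn_ge0 3 t0) x_le.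
  by lia.
by case: (eis_min_form v) => /fin h; [constructor 1 | constructor 2 | constructor 3]; apply: h.
Qed.

Lemma sector_pair_right_coef H A w0 m (s := (eis_sup m)%:Z) x y :
  sector_pair H A w0 m -> eis_norm w0 <= x ^+ 2 + `|x * y| + y ^+ 2 ->
  A%:Z <= 5 * s * `|x| \/ A%:Z <= 5 * s * `|y|.
Proof.
case=> lo _ _ le_n; apply: quad_coef_large le_n _ _ => //.
have [_ hi] := eis_norm_sup m.
have := ler_wpM2l (eis_norm_ge0 w0) hi; rewrite -/s.
have := mulr_ge0 (sqr_ge0 s) (eis_norm_ge0 w0).
by lia.
Qed.

(** * Counting *)

Section Counting.

Variable R : realType.

(** Bounding duplicate-free lists gives a cardinality bound without a prior proof of finiteness. *)
Definition card_le {T : eqType} (P : T -> Prop) (B : R) : Prop :=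
  forall s : seq T, uniq s -> (forall x, x \in s -> P x) -> (size s)%:R <= B.

Lemma card_leW (T : eqType) (P : T -> Prop) B B' : card_le P B -> B <= B' -> card_le P B'.
Proof. by move=> PB BB' s us sP; apply: le_trans (PB s us sP) BB'. Qed.

Lemma card_le_sub (T : eqType) (P Q : T -> Prop) B :
  (forall x, P x -> Q x) -> card_le Q B -> card_le P B.
Proof. by move=> PQ QB s us sP; apply: QB => // x /sP/PQ. Qed.

Lemma card_leU (T : eqType) (P Q S : T -> Prop) B C :
  (forall x, S x -> P x \/ Q x) -> card_le P B -> card_le Q C -> card_le S (B + C).
Proof.
move=> SPQ PB QC s us sS; pose p x := `[< P x >].
rewrite -(count_predC p) natrD -!size_filter; apply: lerD.
  by apply: PB; rewrite ?filter_uniq // => x; rewrite mem_filter => /andP[/asboolP].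
apply: QC; rewrite ?filter_uniq // => x; rewrite mem_filter => /andP[/asboolP nP].
by case/sS/SPQ.
Qed.

Lemma card_le_empty (T : eqType) (P : T -> Prop) B :
  0 <= B -> (forall x, ~ P x) -> card_le P B.
Proof. by move=> B0 nP [|x s] // _ /(_ x (mem_head _ _))/nP. Qed.

(** A relation replaces an injection because the images, such as [(w, m)], are only known to exist;
    choice picks one, with [u0] as default outside [P]. *)
Lemma card_le_rel (T : eqType) (U : eqType) (u0 : U) (P : T -> Prop) (Q : U -> Prop)
    (r : T -> U -> Prop) B :
  (forall x, P x -> exists2 y, Q y & r x y) ->
  (forall x x' y, r x y -> r x' y -> x = x') -> card_le Q B -> card_le P B.
Proof.
move=> PQ r_inj QB s us sP.
have /boolp.choice[f fP] : forall x, exists y, P x -> Q y /\ r x y.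
  move=> x; case: (pselect (P x)) => [/PQ[y Qy rxy]|nPx]; last by exists u0.
  by exists y.
rewrite -(size_map f); apply: QB => [|y /mapP[x /sP/fP[Qy _] ->] //].
rewrite map_inj_in_uniq // => x x' /sP/fP[_ rx] /sP/fP[_ rx'] eqf.
by apply: r_inj rx _; rewrite eqf.
Qed.

Lemma card_le_fiber (T U : eqType) (f : T -> U) (P : T -> Prop) (Q : U -> Prop) N B :
  0 <= B -> (forall x, P x -> Q (f x)) -> card_le Q N ->
  (forall y, Q y -> card_le (fun x => P x /\ f x = y) B) -> card_le P (N * B).
Proof.
move=> B0 PQ QN fB s us sP; pose r := undup (map f s).
have rQ y : y \in r -> Q y by rewrite mem_undup => /mapP[x /sP/PQ Qx ->].
apply: le_trans (_ : (size r)%:R * B <= _); last first.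
  by rewrite ler_wpM2r // QN ?undup_uniq.
have : forall x, x \in s -> f x \in r by move=> x sx; rewrite mem_undup map_f.
clearbody r; elim: r s rQ us sP => [|y r IH] s rQ us sP s_r.
  case: s {us sP} s_r => [|x s /(_ x (mem_head _ _))//]; by rewrite mul0r.
rewrite -(count_predC (fun x => f x == y)) natrD -!size_filter.
rewrite [size (y :: r)]/= -nat1r mulrDl mul1r; apply: lerD.
  apply: (fB y (rQ y (mem_head _ _))); first exact: filter_uniq.
  by move=> x; rewrite mem_filter => /andP[/eqP fx /sP].
apply: IH => [z rz|||x]; first by apply: rQ; rewrite inE rz orbT.
- exact: filter_uniq.
- by move=> x; rewrite mem_filter => /andP[_ /sP].
rewrite mem_filter => /andP[/= neq_y /s_r]; rewrite inE => /orP[/eqP fx|//].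
by rewrite fx eqxx in neq_y.
Qed.

Lemma card_le_sum (T : eqType) (f : T -> nat) (P : T -> Prop) (B : nat -> R) m n :
  (forall x, P x -> (m <= f x < n)%N) ->
  (forall k, (m <= k < n)%N -> card_le (fun x => P x /\ f x = k) (B k)) ->
  card_le P (\sum_(m <= k < n) B k).
Proof.
elim: n => [|n IH] in P *.
  by move=> Pf _; apply: card_le_empty => [|x /Pf]; rewrite ?big_geq ?ltn0 ?andbF.
move=> Pf PB; have [le_mn|lt_nm] := leqP m n; last first.
  rewrite big_geq //; apply: card_le_empty => // x /Pf /andP[le_m lt_n].
  by have := leq_ltn_trans le_m lt_n; rewrite ltnNge lt_nm.
rewrite big_nat_recr //=; apply: (@card_leU _ (fun x => P x /\ (f x < n)%N)
  (fun x => P x /\ f x = n)).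
- move=> x Px; have /andP[_] := Pf x Px; rewrite ltnS leq_eqVlt.
  by case/orP=> [/eqP|]; [right | left].
- apply: IH => [x [/Pf/andP[-> _]] //|k /andP[mk kn]].
  apply: card_le_sub (PB k _); last by rewrite mk ltnW // ltnS ltnW.
  by move=> x [[]].
by apply: PB; rewrite le_mn /=.
Qed.

(** With [k] the least natural number above [D], distinct elements are incongruent modulo [k], and
    [k <= D + 1]. *)
Lemma card_le_diam (P : int -> Prop) (D : R) :
  0 <= D -> (forall x y, P x -> P y -> `|(x - y)%:~R| <= D) -> card_le P (D + 1).
Proof.
move=> D0 PD s us sP; pose k := (Num.truncn D).+1.
have lt_D : D < k%:R by rewrite truncnS_gt.
apply: le_trans (_ : k%:R <= _); last by rewrite -natr1 lerD2r truncn_le.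
rewrite ler_nat -(size_iota 0 k) -(size_map (fun x : int => `|(x %% k)%Z|%N)).
apply: uniq_leq_size.
  rewrite map_inj_in_uniq // => x y /sP Px /sP Py.
  have := le_lt_trans (PD x y Px Py) lt_D.
  rewrite -intr_norm -[k%:R]/((k : int)%:~R) ltr_int => lt_k E.
  have {}E : (x %% k)%Z = (y %% k)%Z.
    by have := @modz_ge0 x k isT; have := @modz_ge0 y k isT; lia.
  have /dvdzP[q Dq] : (k %| x - y)%Z by rewrite -eqz_mod_dvd E.
  move: lt_k; rewrite Dq normrM [X in _ * X]ger0_norm // => q_lt.
  have q_lt1 : `|q| < 1 by rewrite -(@ltr_pM2r _ (k : int)) // mul1r.
  have q0 : q = 0 by lia.
  by apply/eqP; rewrite -subr_eq0 Dq q0 mul0r.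
move=> y /mapP[x _ ->]; rewrite mem_iota /= add0n.
by have := @modz_ge0 x k isT; have := @ltz_pmod x k isT; lia.
Qed.

Lemma card_le_ball (M : R) : 0 <= M -> card_le (fun x : int => `|x%:~R| <= M) (2 * M + 1).
Proof.
move=> M0; apply: card_le_diam => [|x y xM yM]; first by lra.
by rewrite rmorphB /= (le_trans (ler_normB _ _)) //; lra.
Qed.

Lemma card_le_affine (p c : int) (K Q : R) : 0 <= K -> 0 < Q -> Q <= `|p%:~R| ->
  card_le (fun x : int => `|(p * x + c)%:~R| <= K) (2 * K / Q + 1).
Proof.
move=> K0 Q0 Qp; apply: card_le_diam => [|x y xK yK].
  by rewrite divr_ge0 ?mulr_ge0 // ltW.
rewrite ler_pdivlMr //; apply: le_trans (_ : `|(x - y)%:~R| * `|p%:~R| <= _).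
  by rewrite ler_wpM2l.
rewrite -normrM -intrM.
have -> : (x - y) * p = (p * x + c) - (p * y + c) by ring.
by rewrite rmorphB /= (le_trans (ler_normB _ _)) //; lra.
Qed.

(** The coordinate whose coefficient may be small ranges over [[-M, M]]; once it is fixed, the other
    one lies in an interval of length [2 K / Q]. *)
Lemma card_le_strip (p q : int) (M K Q : R) :
  0 <= M -> 0 <= K -> 0 < Q -> Q <= `|p%:~R| \/ Q <= `|q%:~R| ->
  card_le (fun w : eis => [/\ `|w.1%:~R| <= M, `|w.2%:~R| <= M
    & `|(p * w.1 + q * w.2)%:~R| <= K]) ((2 * M + 1) * (2 * K / Q + 1)).
Proof.
move=> M0 K0 Q0 Qpq.
have B0 : 0 <= 2 * K / Q + 1 by rewrite addr_ge0 // divr_ge0 ?mulr_ge0 // ltW.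
case: Qpq => [Qp|Qq].
- apply: (@card_le_fiber _ _ snd _ _ _ _ B0 _ (card_le_ball _ M0)) => [w [] //|y _].
  apply: card_le_rel (0 : int) _ _ (fun w x => w = (x, y)) _ _ _ (card_le_affine p (q * y) _ _ K0 Q0 Qp).
    by move=> [u v] [[_ _ uvK] /= vy]; exists u; rewrite -vy.
  by move=> w w' x -> ->.
apply: (@card_le_fiber _ _ fst _ _ _ _ B0 _ (card_le_ball _ M0)) => [w [] //|x _].
apply: card_le_rel (0 : int) _ _ (fun w y => w = (x, y)) _ _ _ (card_le_affine q (p * x) _ _ K0 Q0 Qq).
  by move=> [u v] [[_ _ uvK] /= ux]; exists v; rewrite -ux // addrC.
by move=> w w' y -> ->.
Qed.

Lemma eis_sup_ge z : `|z.1%:~R| <= (eis_sup z)%:R :> R /\ `|z.2%:~R| <= (eis_sup z)%:R :> R.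
Proof.
by split; rewrite -intr_norm pmulrn ler_int /eis_sup; lia.
Qed.

(** Four sides of a square with [2 m + 1] points each. *)
Lemma card_le_shell m : (0 < m)%N -> card_le (fun z : eis => eis_sup z = m) (12 * m%:R).
Proof.
move=> m0; have m1 : 1 <= m%:R :> R by rewrite ler1n.
have B0 : 0 <= 2 * m%:R + 1 :> R by lra.
have two : card_le (fun x : int => `|x|%N = m) 2.
  move=> s us sP; have : (size s <= size [:: m : int; - (m : int)])%N.
    by apply: uniq_leq_size => // x /sP; rewrite !inE; lia.
  by rewrite -(ler_nat R).
apply: card_leW (_ : 2 * (2 * m%:R + 1) + 2 * (2 * m%:R + 1) <= _); last by lra.
apply: (@card_leU _ (fun z : eis => `|z.1|%N = m /\ (`|z.2|%N <= m)%N)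
  (fun z => `|z.2|%N = m /\ (`|z.1|%N <= m)%N)) => [z||].
- by rewrite /eis_sup; lia.
- apply: (@card_le_fiber _ _ fst _ _ _ _ B0 _ two) => [z [] //|x _].
  apply: card_le_rel (0 : int) _ _ (fun w y => w = (x, y)) _ _ _ (card_le_ball _ (ler0n R m)).
    by move=> [u v] [[_ /= vm] ux]; exists v; rewrite -?ux // -intr_norm pmulrn ler_int; lia.
  by move=> w w' y -> ->.
apply: (@card_le_fiber _ _ snd _ _ _ _ B0 _ two) => [z [] //|y _].
apply: card_le_rel (0 : int) _ _ (fun w x => w = (x, y)) _ _ _ (card_le_ball _ (ler0n R m)).
  by move=> [u v] [[_ /= um] vy]; exists u; rewrite -?vy // -intr_norm pmulrn ler_int; lia.
by move=> w w' x -> ->.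
Qed.

(** A strip of length about [A / s] and width about [H / (A s)]. The condition [s <= 3 A] lets the
    length absorb its [+ 1]; the [+ 1] on the width leaves the term [A / s]. *)
Lemma card_le_scale_left (H A : nat) (w : eis) (s := (eis_sup w)%:R : R) :
  (0 < A)%N -> (0 < eis_sup w)%N -> (eis_sup w <= 3 * A)%N ->
  card_le (sector_pair H A w) (7776 * H%:R / s ^+ 2 + 9 * A%:R / s).
Proof.
move=> A0 s0 sA; have a0 : 0 < A%:R :> R by rewrite ltr0n.
have convK (x : int) : `|x| * A%:Z <= 162 * H%:Z * (eis_sup w)%:Z ^+ 2 ->
    `|x%:~R| <= 162 * H%:R * s ^+ 2 / A%:R :> R.
  by rewrite ler_pdivlMr // -(ler_int R) -intr_norm /s => le_x; lra.
have {}s0 : 0 < s by rewrite ltr0n.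
have h0 : 0 <= H%:R :> R by [].
have {}sA : s <= 3 * A%:R by rewrite -natrM ler_nat.
pose u := A%:R / s; pose K := 162 * H%:R * s ^+ 2 / A%:R.
pose Q := 3 / 8 * s ^+ 3; pose e := 2 * K / Q.
have u1 : 1 <= 3 * u by rewrite /u mulrA ler_pdivlMr // mul1r.
have De : e = 864 * (H%:R / (A%:R * s)) by rewrite /e /K /Q; field; rewrite !gt_eqF.
have e0 : 0 <= e by rewrite De !mulr_ge0 ?invr_ge0 ?mulr_ge0 // ltW.
have u0 : 0 <= 3 * u by lra.
have K0 : 0 <= K by rewrite /K divr_ge0 ?mulr_ge0 ?exprn_ge0 // ltW.
have Q0 : 0 < Q by rewrite /Q mulr_gt0 ?exprn_gt0 // divr_gt0.
apply: card_leW (_ : (2 * (3 * u) + 1) * (e + 1) <= _); last first.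
  apply: le_trans (_ : (9 * u) * (e + 1) <= _); first by rewrite ler_wpM2r; lra.
  rewrite le_eqVlt; apply/orP; left; apply/eqP; rewrite De /u; field.
  by rewrite !gt_eqF.
pose z := w ^+ 3.
have conv (x : int) : 3 * (eis_sup w)%:Z ^+ 3 <= 8 * `|x| -> Q <= `|x%:~R| :> R.
  by rewrite -(ler_int R) /Q -intr_norm /s => le_x; lra.
have Qz : Q <= `|z.2%:~R| \/ Q <= `|(z.1 - z.2)%:~R|.
  by case: (sector_pair_left_coef w) => /conv; [left | right].
apply: card_le_sub (card_le_strip z.2 (z.1 - z.2) (3 * u) K Q u0 K0 Q0 Qz).
move=> m wm; have k_le := sector_pair_sup _ _ _ _ wm.
have {}k_le : (eis_sup m)%:R <= 3 * u.
  by rewrite /u mulrA ler_pdivlMr // mulrC -!natrM ler_nat.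
have [m1 m2] := eis_sup_ge m; split; try exact: le_trans k_le.
have := sector_pair_left_int _ _ _ _ A0 wm.
have -> : (w ^+ 3 * m).2 = z.2 * m.1 + (z.1 - z.2) * m.2 by rewrite eisE /z; ring.
exact: convK.
Qed.

(** Three strips around one fixed solution, each with [1872 * 4 / 3 = 2496] in its bound [K] since
    the norm of [m] is at least [3 s^2 / 4]. *)
Lemma card_le_scale_right (H A : nat) (m : eis) (s := (eis_sup m)%:R : R) :
  (0 < A)%N -> (0 < eis_sup m)%N -> (eis_sup m <= 3 * A)%N ->
  card_le (fun w => sector_pair H A w m) (4320 * 156 * H%:R / s ^+ 2 + 27 * A%:R / s).
Proof.
move=> A0 s0 sA; have a0 : 0 < A%:R :> R by rewrite ltr0n.
have {}s0 : 0 < s by rewrite ltr0n.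
have h0 : 0 <= H%:R :> R by [].
have {}sA : s <= 3 * A%:R by rewrite -natrM ler_nat.
pose u := A%:R / s; pose K := 2496 * H%:R / s ^+ 2; pose Q := A%:R / (5 * s).
pose e := 2 * K / Q.
have u1 : 1 <= 3 * u by rewrite /u mulrA ler_pdivlMr // mul1r.
have De : e = 160 * 156 * (H%:R / (A%:R * s)) by rewrite /e /K /Q; field; rewrite !gt_eqF.
have e0 : 0 <= e by rewrite De !mulr_ge0 ?invr_ge0 ?mulr_ge0 // ltW.
have u0 : 0 <= 3 * u by lra.
have K0 : 0 <= K by rewrite /K divr_ge0 ?mulr_ge0 ?exprn_ge0 // ltW.
have Q0 : 0 < Q by rewrite /Q divr_gt0 // mulr_gt0.
pose B := (2 * (3 * u) + 1) * (e + 1).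
have leB : B + (B + B) <= 4320 * 156 * H%:R / s ^+ 2 + 27 * A%:R / s.
  have : B <= (9 * u) * (e + 1) by rewrite ler_wpM2r; lra.
  have -> : 4320 * 156 * H%:R / s ^+ 2 + 27 * A%:R / s = 3 * (9 * u * (e + 1)).
    by rewrite De /u; field; rewrite !gt_eqF.
  by lra.
(* Any solution serves as the reference point; without one there is nothing to count. *)
have [[w0 w0P]|no_w] := pselect (exists w0, sector_pair H A w0 m); last first.
  apply: card_le_empty => [|w wP]; last by apply: no_w; exists w.
  have B0 : 0 <= B by rewrite /B mulr_ge0 // addr_ge0 // mulr_ge0.
  by apply: le_trans leB; rewrite !addr_ge0.
apply: card_leW leB; pose p := (eis_conj w0).1; pose q := (eis_conj w0).2.
have strip x y : eis_norm (eis_conj w0) <= x ^+ 2 + `|x * y| + y ^+ 2 ->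
    card_le (fun w : eis => [/\ `|w.1%:~R| <= 3 * u, `|w.2%:~R| <= 3 * u
      & `|(x * w.1 + y * w.2)%:~R| <= K]) B.
  rewrite eis_norm_conj => le_xy; apply: (@card_le_strip x y (3 * u) K Q u0 K0 Q0).
  have conv (z : int) : A%:Z <= 5 * (eis_sup m)%:Z * `|z| -> Q <= `|z%:~R|.
    rewrite -(ler_int R) /Q ler_pdivrMr ?mulr_gt0 // -intr_norm /s => le_z.
    by lra.
  by case: (sector_pair_right_coef _ _ _ _ _ _ w0P le_xy) => /conv; [left | right].
have convK (z : int) : eis_norm m * `|z| <= 1872 * H%:Z -> `|z%:~R| <= K.
  move=> le_z; rewrite /K ler_pdivlMr ?exprn_gt0 //.
  have [lo _] := eis_norm_sup m.
  have : `|z| * (eis_sup m)%:Z ^+ 2 <= 2496 * H%:Z.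
    by have := ler_wpM2l (normr_ge0 z) lo; lia.
  by rewrite -(ler_int R) -intr_norm /s => le_m; lra.
have bnd w : sector_pair H A w m -> `|w.1%:~R| <= 3 * u /\ `|w.2%:~R| <= 3 * u.
  move=> wP; have k_le := sector_pair_sup _ _ _ _ wP.
  have {}k_le : (eis_sup w)%:R <= 3 * u.
    by rewrite /u mulrA ler_pdivlMr // -!natrM ler_nat.
  by have [w1 w2] := eis_sup_ge w; split; apply: le_trans k_le.
pose form x y (w : eis) := [/\ `|w.1%:~R| <= 3 * u, `|w.2%:~R| <= 3 * u
  & `|(x * w.1 + y * w.2)%:~R| <= K].
apply: (@card_leU _ (form p (- q)) (fun w => form q (p - q) w \/ form (p - q) (- p) w)).
- move=> w wP; have [w1 w2] := bnd w wP.
  case: (sector_pair_right_int _ _ _ _ _ A0 wP w0P) => /convK z_le.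
  + left; split=> //; apply: le_trans z_le; rewrite le_eqVlt; apply/orP; left.
    by apply/eqP; congr (`| _%:~R |); rewrite eisE /p /q; ring.
  + right; left; split=> //; apply: le_trans z_le; rewrite le_eqVlt; apply/orP; left.
    by apply/eqP; congr (`| _%:~R |); rewrite eisE /p /q; ring.
  right; right; split=> //; apply: le_trans z_le; rewrite le_eqVlt; apply/orP; left.
  by apply/eqP; congr (`| _%:~R |); rewrite !eisE /p /q; ring.
- by apply: strip; have [] := eis_norm_forms (eis_conj w0).
apply: (@card_leU _ (form q (p - q)) (form (p - q) (- p))) => //; apply: strip.
  by have [] := eis_norm_forms (eis_conj w0).
by have [] := eis_norm_forms (eis_conj w0).
Qed.

End Counting.

(** * From cubics to pairs of Eisenstein integers *)

Section GoodTriples.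

Variables (H : nat).

(** What the counting retains of a cubic: the value of [i], and [9 y^2] as the square of the second
    coordinate of [z], which is [w ^+ 3 * m] times the norm of [m]. *)
Definition good_triple (a : int) (w m : eis) : Prop :=
  [/\ (`|a| <= H)%N, w != 0, m != 0 &
    exists b c : int, [/\ (`|b| <= H)%N, (`|c| <= H)%N,
      a ^+ 2 - 3 * b = eis_norm w * eis_norm m
    & (eis_norm m * (w ^+ 3 * m).2) ^+ 2 = 9 * cubic_disc a b c]].

(** Termwise the total is below [73 A^2 h^2]; 81 is used because [9 * 81 = 27^2]. *)
Lemma cubic_disc_bound (A h a b c : int) : 1 <= A -> A <= h -> 6 * h <= A ^+ 2 ->
  `|a| <= 2 * A -> `|b| <= h -> `|c| <= h ->
  cubic_disc a b c <= 81 * A ^+ 2 * h ^+ 2.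
Proof.
move=> A1 Ah hA aA bh ch.
have a0 := normr_ge0 a; have b0 := normr_ge0 b; have c0 := normr_ge0 c.
have h0 : 0 <= h by lia.
have t1 : a ^+ 2 * b ^+ 2 <= (2 * A) ^+ 2 * h ^+ 2.
  by rewrite -[a ^+ 2]normz_sqr -[b ^+ 2]normz_sqr ler_pM ?sqr_ge0 // lerXn2r ?nnegrE //; lia.
have t2 : - b ^+ 3 <= h ^+ 3.
  apply: le_trans (ler_norm _) _; rewrite normrN normrX lerXn2r ?nnegrE //; lia.
have t3 : - (a ^+ 3 * c) <= (2 * A) ^+ 3 * h.
  apply: le_trans (ler_norm _) _; rewrite normrN normrM normrX ler_pM ?exprn_ge0 //.
  by rewrite lerXn2r ?nnegrE //; lia.
have t4 : a * b * c <= (2 * A) * h * h.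
  apply: le_trans (ler_norm _) _; rewrite !normrM ler_pM ?mulr_ge0 // ler_pM //.
have t5 : h ^+ 2 * (6 * h) <= h ^+ 2 * A ^+ 2 by rewrite ler_wpM2l ?sqr_ge0.
have t6 : A ^+ 2 * h * A <= A ^+ 2 * h * h.
  by rewrite ler_wpM2l // mulr_ge0 ?sqr_ge0.
have t7 : h ^+ 2 * A * 1 <= h ^+ 2 * A * A.
  by rewrite ler_wpM2l // mulr_ge0 ?sqr_ge0 //; lia.
have t8 := sqr_ge0 c.
have t9 : 0 <= A ^+ 2 * h ^+ 2 by rewrite mulr_ge0 ?sqr_ge0.
rewrite /cubic_disc; clear -t1 t2 t3 t4 t5 t6 t7 t8 t9.
have -> : a ^+ 2 * b ^+ 2 - 4 * b ^+ 3 - 4 * a ^+ 3 * c - 27 * c ^+ 2 + 18 * a * b * c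
  = a ^+ 2 * b ^+ 2 + 4 * - b ^+ 3 + 4 * - (a ^+ 3 * c) - 27 * c ^+ 2 + 18 * (a * b * c) by ring.
move: (a ^+ 2 * b ^+ 2) (- b ^+ 3) (- (a ^+ 3 * c)) (c ^+ 2) (a * b * c) t1 t2 t3 t4 t8.
lia.
Qed.

(** As [6 H <= A^2], the term [3 b] is at most [A^2 / 2], so [i] lies between [A^2 / 2] and
    [5 A^2]. *)
Lemma good_triple_sector A a w m : (A <= `|a|)%N -> (`|a| <= 2 * A)%N ->
  (0 < A)%N -> (6 * H <= A ^ 2)%N -> good_triple a w m -> sector_pair H A w m.
Proof.
move=> A_le a_le A0 HA [aH _ _ [b [c [bH cH DI Dy]]]].
have HA' : 6 * H%:Z <= A%:Z ^+ 2 by move: HA; rewrite -(ler_nat int) natrM natrX !natz; lia.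
have lo : A%:Z ^+ 2 <= a ^+ 2.
  by rewrite -[a ^+ 2]normz_sqr lerXn2r ?nnegrE //; lia.
have hi : a ^+ 2 <= (2 * A%:Z) ^+ 2.
  by rewrite -[a ^+ 2]normz_sqr lerXn2r ?nnegrE //; lia.
split; first by rewrite -DI; lia.
  by rewrite -DI; lia.
have t0 := eis_norm_ge0 m.
rewrite -[X in X * _](ger0_norm t0) -normrM.
rewrite -(@ler_pXn2r _ 2) ?nnegrE ?mulr_ge0 // normz_sqr Dy.
have := @cubic_disc_bound A%:Z H%:Z a b c; move: (cubic_disc a b c) => d le_d.
have {}le_d : d <= 81 * A%:Z ^+ 2 * H%:Z ^+ 2 by apply: le_d; lia.
by lia.
Qed.

Lemma good_triple_square a w m : good_triple a w m ->
  `|a ^+ 2 - eis_norm w * eis_norm m| <= 3 * H%:Z.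
Proof. by case=> _ _ _ [b [c [bH cH DI _]]]; lia. Qed.

Lemma good_triple_bottom a w m : good_triple a w m -> (`|a| ^ 2 <= 24 * H)%N ->
  ((eis_sup w * eis_sup m) ^ 2 <= 48 * H)%N.
Proof.
move=> gd a_le; have := good_triple_square _ _ _ gd.
have {}a_le : a ^+ 2 <= 24 * H%:Z.
  by rewrite -normz_sqr; move: a_le; rewrite -(ler_nat int) natrM natrX !natz; lia.
move=> I_le; have /eis_sup_mul : eis_norm w * eis_norm m <= 27 * H%:Z by lia.
by rewrite -(ler_nat int) natrM natrX natrM !natz; lia.
Qed.

End GoodTriples.

Lemma odd_sqrz (x : int) : exists k, x ^+ 2 = x + 2 * k.
Proof.
have [q [r [-> r01]]] : exists q r : int, x = q * 2 + r /\ (r = 0 \/ r = 1).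
  exists (x %/ 2)%Z, (x %% 2)%Z; split; first exact: divz_eq.
  by have := @modz_ge0 x 2 isT; have := @ltz_pmod x 2 isT; lia.
by exists (2 * q ^+ 2 + 2 * q * r - q); case: r01 => ->; ring.
Qed.

(** The two final equations let [b] and then [c] be recovered from [(a, w, m)]. *)
Lemma cubic_good_triple (H : nat) (a b c : int) :
  (`|a| <= H)%N -> (`|b| <= H)%N -> (`|c| <= H)%N ->
  irreducible_poly (cubic a b c) -> ~ galois_group_isog_S3 (cubic a b c) ->
  exists w m, good_triple H a w m /\
    a ^+ 2 - 3 * b = eis_norm w * eis_norm m /\
    2 * a ^+ 3 - 9 * a * b + 27 * c =
      eis_norm m * (2 * (w ^+ 3 * m).1 - (w ^+ 3 * m).2).
Proof.
move=> aH bH cH irr nS3; have [y Dy] := nonS3_disc_square _ _ _ irr nS3.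
pose i := a ^+ 2 - 3 * b; pose j := 2 * a ^+ 3 - 9 * a * b + 27 * c.
have Eij : 4 * i ^+ 3 = j ^+ 2 + 27 * y ^+ 2 by rewrite Dy /i /j /cubic_disc; ring.
(* The relation [Eij] makes [j] and [y] congruent modulo 2, so [z] has integer coordinates. *)
have [k Dk] : exists k, j + 3 * y = 2 * k.
  have [k1 E1] := odd_sqrz j; have [k2 E2] := odd_sqrz y.
  exists (2 * i ^+ 3 - k1 - 27 * k2 - 12 * y); lia.
pose z : eis := (k, 3 * y).
have Nz : eis_norm z = i ^+ 3.
  suff : 4 * eis_norm z = 4 * i ^+ 3 by lia.
  transitivity ((2 * k - 3 * y) ^+ 2 + 27 * y ^+ 2); first by rewrite /eis_norm /=; ring.
  by rewrite Eij -Dk; ring.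
(* The value of the cubic at [- a / 3] is [j / 27], so [j = 0] would give a rational root. *)
have j0 : j != 0.
  apply/eqP=> j0; pose r : rat := - (a%:~R / 3).
  have fr : root (cubic a b c) r.
    rewrite rootE /cubic !(hornerD, hornerCM, hornerXn, hornerX, hornerC).
    apply/eqP.
    transitivity (j%:~R / 27 : rat); last by rewrite j0 mul0r.
    by rewrite /j /r; field.
  have [_ /(_ ('X - r%:P))] := irr; rewrite size_XsubC dvdp_XsubCl fr => /(_ isT isT).
  by move/eqp_size; rewrite size_XsubC size_cubic.
have z0 : z != 0.
  have Dj : j = 2 * z.1 - z.2 by rewrite /z /= -Dk; ring.
  by apply: contraNneq j0 => z0; rewrite Dj z0.
have [w [m Dz]] := eis_cubic_norm _ _ z0 Nz.
have Dz' : z = (w ^+ 3 * m) * eis_int (eis_norm m) by rewrite Dz -eis_mul_conj; ring.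
have w0 : w != 0 by apply: contraNneq z0 => w0; rewrite Dz w0 expr0n mul0r.
have m0 : m != 0 by apply: contraNneq z0 => m0; rewrite Dz m0 expr0n mul0r mulr0.
have DI : i = eis_norm w * eis_norm m.
  have : i ^+ 3 = (eis_norm w * eis_norm m) ^+ 3.
    by rewrite -Nz Dz !eis_normM eis_norm_conj; ring.
  have i_ge0 : 0 <= i by rewrite -(@exprn_odd_ge0 _ 3) // -Nz eis_norm_ge0.
  have wm_ge0 : 0 <= eis_norm w * eis_norm m by rewrite mulr_ge0 ?eis_norm_ge0.
  by move/eqP; rewrite eqrXn2 // => /eqP.
have z1 : k = eis_norm m * (w ^+ 3 * m).1.
  by rewrite -[k]/(z.1) Dz' eisE /=; ring.
have z2 : 3 * y = eis_norm m * (w ^+ 3 * m).2.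
  by rewrite -[3 * y]/(z.2) Dz' eisE /=; ring.
exists w, m; split; last split=> //.
  by split=> //; exists b, c; split=> //; rewrite -z2 -Dy; ring.
rewrite mulrBr -z2; have -> : eis_norm m * (2 * (w ^+ 3 * m).1) = 2 * k.
  by rewrite z1; ring.
by rewrite -Dk /j; ring.
Qed.

(** * Summation *)

Section Sums.

Variable R : realType.

Local Notation card_le := (@card_le R _).
(** The leading coefficient of the count for fixed [m]; it dominates the other coefficients of both
    strip counts. *)
Let cst : R := 4320 * 156.

Definition harm (n : nat) : R := \sum_(1 <= k < n.+1) (k%:R)^-1.

Lemma harm_ge0 n : 0 <= harm n.
Proof. by rewrite /harm sumr_ge0 // => k _; rewrite invr_ge0. Qed.

(** The induction step is [ln (x / (x + 1)) <= - 1 / (x + 1)]. *)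
Lemma harm_le_ln n : (0 < n)%N -> harm n <= 1 + ln n%:R.
Proof.
elim: n => // n IH _; case: n IH => [|n] IH.
  by rewrite /harm big_nat1 invr1 ln1 addr0.
rewrite /harm big_nat_recr //= -/(harm n.+1); have {}IH := IH isT.
set x : R := n.+1%:R; have x0 : 0 < x by rewrite ltr0n.
have -> : n.+2%:R = x + 1 :> R by rewrite /x natr1.
have x1 : 0 < x + 1 by lra.
have := @le_ln1Dx R (x / (x + 1) - 1).
have -> : 1 + (x / (x + 1) - 1) = x / (x + 1) by ring.
rewrite ln_div ?posrE //.
have -> : x / (x + 1) - 1 = - (x + 1)^-1 by field; apply: lt0r_neq0; lra.
have h1 : (x + 1)^-1 < 1 by rewrite invf_lt1 //; lra.
by move=> /(_ ltac:(lra)); lra.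
Qed.

Lemma harm_sum (h a : R) X :
  \sum_(1 <= k < X.+1) (12 * k%:R * (cst * (h / k%:R ^+ 2 + a / k%:R)))
  = 12 * cst * (h * harm X + a * X%:R).
Proof.
rewrite /harm mulr_sumr; have -> : X%:R = \sum_(1 <= k < X.+1) (1 : R).
  by rewrite sumr_const_nat subn1.
rewrite mulr_sumr -big_split /= mulr_sumr; apply: eq_big_nat => k /andP[k0 _].
have k0' : (k%:R : R) != 0 by rewrite pnatr_eq0 -lt0n.
by move: cst => c; field.
Qed.

Lemma card_le_pair_half (P : eis -> eis -> Prop) (h a : R) X : 0 <= h -> 0 <= a ->
  (forall w, (0 < eis_sup w <= X)%N ->
     card_le (P w) (cst * (h / (eis_sup w)%:R ^+ 2 + a / (eis_sup w)%:R))) ->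
  card_le (fun t : eis * eis => (0 < eis_sup t.1 <= X)%N /\ P t.1 t.2)
    (12 * cst * (h * harm X + a * X%:R)).
Proof.
move=> h0 a0 PB; rewrite -harm_sum.
apply: (@card_le_sum _ _ (fun t : eis * eis => eis_sup t.1)) => [t [] //|k kX].
have B0 : 0 <= cst * (h / k%:R ^+ 2 + a / k%:R).
  by rewrite /cst !mulr_ge0 // addr_ge0 // divr_ge0 // exprn_ge0.
apply: (@card_le_fiber _ _ _ fst _ (fun w => eis_sup w = k) _ _ B0) => [t [] //||w wk].
  by apply: card_le_shell; case/andP: kX.
apply: (@card_le_rel _ _ _ (0 : eis) _ (P w) (fun t m => t = (w, m))).
- by move=> [w' m] /= [[[_ Pwm] _] ww]; exists m; rewrite -ww.
- by move=> t t' m -> ->.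
by rewrite -wk; apply: PB; rewrite wk.
Qed.

(** [X] is the integer square root of [3 A]: two sup norms above it would have a product above
    [3 A]. *)
Lemma card_le_sector_pairs (H A X : nat) :
  (0 < A)%N -> (X ^ 2 <= 3 * A)%N -> (3 * A < X.+1 ^ 2)%N ->
  card_le (fun t : eis * eis => [/\ t.1 != 0, t.2 != 0 & sector_pair H A t.1 t.2])
    (24 * cst * (H%:R * harm X + A%:R * X%:R)).
Proof.
move=> A0 X_le lt_X.
have XA k : (k <= X)%N -> (k <= 3 * A)%N.
  by move=> kX; apply: leq_trans X_le; apply: leq_trans kX _; case: (X) => // n; rewrite expnS leq_pmulr // expn_gt0.
have -> : 24 * cst * (H%:R * harm X + A%:R * X%:R) =
   12 * cst * (H%:R * harm X + A%:R * X%:R) + 12 * cst * (H%:R * harm X + A%:R * X%:R).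
  by move: cst => c; ring.
have cst_le (x y : R) (s : nat) : x <= cst -> y <= cst ->
    x * H%:R / s%:R ^+ 2 + y * A%:R / s%:R <= cst * (H%:R / s%:R ^+ 2 + A%:R / s%:R).
  move=> xc yc; rewrite mulrDr; apply: lerD; rewrite -mulrA; apply: ler_wpM2r => //.
    by rewrite divr_ge0 // exprn_ge0.
  by rewrite divr_ge0.
have c1 : 7776 <= cst by rewrite /cst; lra.
have c2 : 9 <= cst by rewrite /cst; lra.
have c3 : 27 <= cst by rewrite /cst; lra.
apply: (@card_leU _ _ (fun t => (0 < eis_sup t.1 <= X)%N /\ sector_pair H A t.1 t.2)
  (fun t => (0 < eis_sup t.2 <= X)%N /\ sector_pair H A t.1 t.2)).
- move=> t [w0 m0 tP]; rewrite !eis_sup_gt0 w0 m0 /=.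
  have [|X_lt1] := leqP (eis_sup t.1) X; first by left.
  have [|X_lt2] := leqP (eis_sup t.2) X; first by right.
  have := leq_trans (leq_mul X_lt1 X_lt2) (sector_pair_sup _ _ _ _ tP).
  by rewrite mulnn leqNgt lt_X.
- apply: (@card_le_pair_half (sector_pair H A)) => // w /andP[w0 wX].
  by apply: card_leW (card_le_scale_left _ _ _ _ A0 w0 (XA _ wX)) (cst_le _ _ _ c1 c2).
apply: (@card_le_rel _ _ _ (0 : eis * eis)%type _ _ (fun t t' => t' = (t.2, t.1))); last first.
- apply: (@card_le_pair_half (fun m w => sector_pair H A w m)) => [||m /andP[m0 mX]].
  + exact: ler0n.
  + exact: ler0n.
  by apply: card_leW (card_le_scale_right _ _ _ _ A0 m0 (XA _ mX)) (cst_le _ _ _ _ c3).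
- by move=> [x1 x2] [y1 y2] t /= -> [-> ->].
by move=> t tP; exists (t.2, t.1).
Qed.

(** Two admissible [a] of the same sign differ by at most [3 H / A], since
    [2 A |x - y| <= |x^2 - y^2| <= 6 H]. Both signs give at most [6 H / A + 2], and [A <= H] turns
    this into [8 H / A]. *)
Lemma card_le_scale_triples (H A X : nat) :
  (0 < A)%N -> (A <= H)%N -> (6 * H <= A ^ 2)%N ->
  (X ^ 2 <= 3 * A)%N -> (3 * A < X.+1 ^ 2)%N ->
  card_le (fun t : int * (eis * eis) => [/\ (A <= `|t.1|)%N, (`|t.1| <= 2 * A)%N
      & good_triple H t.1 t.2.1 t.2.2])
    (24 * cst * (H%:R * harm X + A%:R * X%:R) * (8 * (H%:R / A%:R))).
Proof.
move=> A0 AH HA X_le lt_X; have a0 : 0 < A%:R :> R by rewrite ltr0n.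
have B0 : 0 <= 8 * (H%:R / A%:R) :> R by rewrite mulr_ge0 // divr_ge0.
apply: (@card_le_fiber _ _ _ snd _ _ _ _ B0 _ (card_le_sector_pairs _ _ _ A0 X_le lt_X)).
  move=> t [A_le a_le gt]; have [_ w0 m0 _] := gt; split=> //.
  exact: good_triple_sector gt.
move=> [w m] _.
apply: (@card_le_rel _ _ _ (0 : int) _ (fun a : int => (A <= `|a|)%N /\
    `|a ^+ 2 - eis_norm w * eis_norm m| <= 3 * H%:Z) (fun t a => t = (a, (w, m)))).
- move=> [a wm] /= [[A_le a_le gt] wmE]; rewrite wmE in gt *.
  by exists a => //; split=> //; apply: good_triple_square gt.
- by move=> t t' a -> ->.
have HA1 : 1 <= H%:R / A%:R :> R by rewrite ler_pdivlMr // mul1r ler_nat.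
apply: card_leW (_ : (3 * (H%:R / A%:R) + 1) + (3 * (H%:R / A%:R) + 1) <= _); last by lra.
have D0 : 0 <= 3 * (H%:R / A%:R) :> R by lra.
have conv (x y : int) : `|x - y| * A%:Z <= 3 * H%:Z -> `|(x - y)%:~R| <= 3 * (H%:R / A%:R) :> R.
  by rewrite mulrA ler_pdivlMr // -(ler_int R) -intr_norm => h; lra.
apply: (@card_leU _ _ (fun a : int => A%:Z <= a /\
    `|a ^+ 2 - eis_norm w * eis_norm m| <= 3 * H%:Z)
   (fun a : int => a <= - A%:Z /\ `|a ^+ 2 - eis_norm w * eis_norm m| <= 3 * H%:Z)).
- by move=> a [A_le ?]; case: (leP 0 a) => a0'; [left|right]; split=> //; lia.
- apply: card_le_diam => // x y [xA xI] [yA yI]; apply: conv.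
  have h : `|x - y| * (x + y) <= 6 * H%:Z.
    have -> : `|x - y| * (x + y) = `|(x - y) * (x + y)| by rewrite normrM [X in _ = _ * X]ger0_norm //; lia.
    have -> : (x - y) * (x + y) = x ^+ 2 - y ^+ 2 by ring.
    by move: xI yI; clear; move: (x ^+ 2) (y ^+ 2) (_ * _) => *; lia.
  have : `|x - y| * (2 * A%:Z) <= `|x - y| * (x + y) by rewrite ler_wpM2l //; lia.
  by move: h; clear; move: `|_| => n; lia.
apply: card_le_diam => // x y [xA xI] [yA yI]; apply: conv.
have h : `|x - y| * - (x + y) <= 6 * H%:Z.
  have -> : `|x - y| * - (x + y) = `|(x - y) * (x + y)| by rewrite normrM [X in _ = _ * X]ler0_norm //; lia.
  have -> : (x - y) * (x + y) = x ^+ 2 - y ^+ 2 by ring.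
  by move: xI yI; clear; move: (x ^+ 2) (y ^+ 2) (_ * _) => *; lia.
have : `|x - y| * (2 * A%:Z) <= `|x - y| * - (x + y) by rewrite ler_wpM2l //; lia.
by move: h; clear; move: `|_| => n; lia.
Qed.

(** The shell of radius [k] has at most [12 k] points [w], each with at most [(3 Y / k)^2] values of
    [m]; there are at most [3 Y] values of [a]. *)
Lemma card_le_bottom_triples (H Y : nat) :
  (0 < Y)%N -> (48 * H < Y.+1 ^ 2)%N ->
  card_le (fun t : int * (eis * eis) => (`|t.1| ^ 2 <= 24 * H)%N /\
      good_triple H t.1 t.2.1 t.2.2)
    (324 * Y%:R ^+ 3 * harm Y).
Proof.
move=> Y0 lt_Y; have y1 : 1 <= Y%:R :> R by rewrite ler1n.
have B0 : 0 <= 3 * Y%:R :> R by lra.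
have -> : 324 * Y%:R ^+ 3 * harm Y =
    (\sum_(1 <= k < Y.+1) (12 * k%:R * (3 * (Y%:R / k%:R)) ^+ 2)) * (3 * Y%:R).
  rewrite /harm mulr_sumr mulr_suml; apply: eq_big_nat => k /andP[k0 _].
  by field; rewrite pnatr_eq0 -lt0n.
apply: (@card_le_fiber _ _ _ snd _ (fun t : eis * eis =>
   [/\ t.1 != 0, t.2 != 0 & (eis_sup t.1 * eis_sup t.2 <= Y)%N]) _ _ B0).
- move=> t [a_le gt]; have [_ w0 m0 _] := gt; split=> //.
  have := good_triple_bottom _ _ _ _ gt a_le => le_sup.
  by rewrite -ltnS -ltn_sqr; apply: leq_ltn_trans le_sup lt_Y.
- apply: (@card_le_sum _ _ (fun t : eis * eis => eis_sup t.1)).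
    move=> t [w0 m0 le_Y]; rewrite ltnS eis_sup_gt0 w0 /=.
    by apply: leq_trans le_Y; rewrite leq_pmulr // eis_sup_gt0.
  move=> k /andP[k0 kY]; have k0' : 0 < k%:R :> R by rewrite ltr0n.
  have Yk1 : 1 <= Y%:R / k%:R :> R by rewrite ler_pdivlMr // mul1r ler_nat -ltnS.
  have Yk0 : 0 <= Y%:R / k%:R :> R by lra.
  apply: (@card_le_fiber _ _ _ fst _ (fun w => eis_sup w = k)) => [|t [] //||w wk].
  + by rewrite exprn_ge0 //; lra.
  + exact: card_le_shell.
  apply: (@card_le_rel _ _ _ (0 : eis) _ (fun m : eis => `|m.1%:~R| <= Y%:R / k%:R :> R
      /\ `|m.2%:~R| <= Y%:R / k%:R :> R) (fun t m => t = (w, m))).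
  - move=> [w' m] /= [[[_ _ le_Y] _] ww]; exists m; last by rewrite ww.
    have le_m : (eis_sup m)%:R <= Y%:R / k%:R :> R.
      by rewrite ler_pdivlMr // mulrC -natrM ler_nat -wk -ww.
    by have [m1 m2] := eis_sup_ge R m; split; apply: le_trans le_m.
  - by move=> t t' m -> ->.
  have b0 : 0 <= 2 * (Y%:R / k%:R) + 1 :> R by lra.
  apply: card_leW (_ : (2 * (Y%:R / k%:R) + 1) * (2 * (Y%:R / k%:R) + 1) <= _); last first.
    by rewrite expr2 ler_pM //; lra.
  apply: (@card_le_fiber _ _ _ fst _ _ _ _ b0 _ (card_le_ball _ _ Yk0)) => [m [] //|x _].
  apply: (@card_le_rel _ _ _ (0 : int) _ _ (fun m y => m = (x, y)) _ _ _ (card_le_ball _ _ Yk0)).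
    by move=> [u v] [[_ /= vY] ux]; exists v; rewrite -?ux.
  by move=> t t' y -> ->.
move=> [w m] _.
apply: (@card_le_rel _ _ _ (0 : int) _ (fun a : int => `|a%:~R| <= Y%:R :> R)
  (fun t a => t = (a, (w, m)))).
- move=> [a wm] /= [[a_le _] ->]; exists a => //.
  rewrite -intr_norm pmulrn ler_int.
  have : (`|a| < Y.+1)%N.
    by rewrite -ltn_sqr; apply: leq_ltn_trans a_le (leq_ltn_trans _ lt_Y); rewrite leq_mul.
  by lia.
- by move=> t t' a -> ->.
apply: card_leW (card_le_ball _ _ (ler0n R Y)) _; lra.
Qed.

End Sums.

Lemma isqrt_exists n : exists x : nat, (x ^ 2 <= n)%N /\ (n < x.+1 ^ 2)%N.
Proof.
elim: n => [|n [x [le_n lt_n]]]; first by exists 0%N.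
have [le_x|lt_x] := leqP (x.+1 ^ 2) n.+1; last by exists x; rewrite lt_x leqW.
exists x.+1; split=> //; apply: leq_ltn_trans lt_n _.
by rewrite ltn_sqr.
Qed.

(** * Dyadic ranges of [|a|] and the bound for a given [H] *)

Section Assembly.

Variables (R : realType) (H : nat).
Hypothesis H0 : (0 < H)%N.

Let cst : R := 4320 * 156.
Let S : R := Num.sqrt H%:R.
(** The 48 covers [1 + ln 48], by the crude [ln 48 <= 47]. *)
Let lg : R := 48 + ln H%:R.

Let S2 : S ^+ 2 = H%:R. Proof. by rewrite sqr_sqrtr. Qed.
Let S_ge0 : 0 <= S. Proof. exact: sqrtr_ge0. Qed.
Let H_ge1 : 1 <= H%:R :> R. Proof. by rewrite ler1n. Qed.
Let lnH_ge0 : 0 <= ln H%:R :> R. Proof. exact: ln_ge0. Qed.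

Let nat_le_S (x k n : nat) : (x ^ 2 <= k * H)%N -> (k <= n ^ 2)%N -> x%:R <= n%:R * S.
Proof.
move=> x_le k_le; rewrite -(@ler_pXn2r _ 2) ?nnegrE ?mulr_ge0 // exprMn S2.
by rewrite -!natrX -natrM ler_nat (leq_trans x_le) // leq_mul2r k_le orbT.
Qed.

Let harm_le (x k : nat) : (x ^ 2 <= k * H)%N -> (k <= 48)%N -> harm R x <= lg.
Proof.
move=> x_le k_le; case: x x_le => [|x] x_le.
  by rewrite /harm big_geq // /lg; move: lnH_ge0; lra.
apply: le_trans (harm_le_ln _ _ _) _ => //.
have : ln x.+1%:R <= ln (48 * H%:R) :> R.
  rewrite ler_ln ?posrE // ?mulr_gt0 ?ltr0n // -natrM ler_nat.
  apply: leq_trans (_ : x.+1 ^ 2 <= _)%N; first by rewrite expnS leq_pmulr // expn_gt0.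
  by apply: leq_trans x_le _; rewrite leq_mul2r k_le orbT.
rewrite lnM ?posrE ?ltr0n // /lg.
have : ln 48 <= 47 :> R.
  by have := @le_ln1Dx R 47; have -> : 1 + 47 = 48 :> R by []; apply; lra.
by move: (ln _) (ln _) (ln _) => ? ? ?; lra.
Qed.

Let lg_ge : 48 <= lg. Proof. by rewrite /lg; move: lnH_ge0; lra. Qed.

(** With [A = 2 ^ k] and [|a| < 2 A], the condition [24 H < |a|^2] yields [6 H <= A^2]. Then
    [S <= A <= H] bounds both terms by [S ^+ 3], up to [lg]. *)
Lemma card_le_good_scale (k : nat) :
  @card_le R _ (fun t : int * (eis * eis) => ((24 * H < `|t.1| ^ 2)%N /\
      good_triple H t.1 t.2.1 t.2.2) /\ trunc_log 2 `|t.1|%N = k)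
    (384 * cst * (S ^+ 3 * lg)).
Proof.
have c0 : 0 <= cst by rewrite /cst mulr_ge0.
have B0 : 0 <= 384 * cst * (S ^+ 3 * lg).
  by rewrite !mulr_ge0 ?exprn_ge0 //; move: lg_ge; lra.
set P := (X in card_le _ X _).
have [[t0 t0P]|no_t] := pselect (exists t, P t); last first.
  by apply: card_le_empty => // t tP; apply: no_t; exists t.
pose A := (2 ^ k)%N; have A0 : (0 < A)%N by rewrite expn_gt0.
have tA t : P t -> (A <= `|t.1|)%N /\ (`|t.1| < 2 * A)%N.
  case=> -[lt_a _] tk; rewrite /A -tk -expnS trunc_log_ltn //.
  by rewrite trunc_logP // lt0n; apply: contraTneq lt_a => ->.
have [[lt_a gt0] _] := t0P; have [A_le a_lt] := tA t0 t0P.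
have AH : (A <= H)%N by case: gt0 => aH _ _ _; apply: leq_trans aH.
have HA : (6 * H <= A ^ 2)%N.
  have : (`|t0.1| ^ 2 <= (2 * A) ^ 2)%N by rewrite leq_sqr ltnW.
  by rewrite expnMn; move: lt_a; move: (_ ^ 2)%N (A ^ 2)%N => *; lia.
have [X [X_le lt_X]] := isqrt_exists (3 * A).
have {}X_leH : (X ^ 2 <= 3 * H)%N by apply: leq_trans X_le _; rewrite leq_mul2l AH.
have XS : X%:R <= 2 * S by exact: (nat_le_S _ _ 2 X_leH isT).
have hX : harm R X <= lg by exact: (harm_le _ _ X_leH isT).
have a0 : 0 < A%:R :> R by rewrite ltr0n.
have SA : S <= A%:R.
  rewrite -(@ler_pXn2r _ 2) ?nnegrE // S2 -natrX ler_nat.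
  by apply: leq_trans HA; rewrite leq_pmull.
apply: card_leW (_ : 24 * cst * (H%:R * harm R X + A%:R * X%:R) * (8 * (H%:R / A%:R)) <= _).
  apply: card_le_sub (card_le_scale_triples _ _ _ _ A0 AH HA X_le lt_X).
  by move=> t tP; have [? /ltnW ?] := tA t tP; case: tP => -[].
have -> : 24 * cst * (H%:R * harm R X + A%:R * X%:R) * (8 * (H%:R / A%:R)) =
    192 * cst * (H%:R ^+ 2 / A%:R * harm R X + H%:R * X%:R).
  by move: cst => c; field; rewrite gt_eqF.
have h1 : H%:R ^+ 2 / A%:R <= S ^+ 3.
  rewrite ler_pdivrMr // -S2.
  have -> : (S ^+ 2) ^+ 2 = S ^+ 3 * S by ring.
  by rewrite ler_wpM2l // exprn_ge0.
have h2 : H%:R ^+ 2 / A%:R * harm R X <= S ^+ 3 * lg.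
  by rewrite ler_pM ?harm_ge0 // divr_ge0 ?exprn_ge0.
have h3 : H%:R * X%:R <= S ^+ 3 * 2.
  rewrite -S2; have -> : S ^+ 3 * 2 = S ^+ 2 * (2 * S) by ring.
  by rewrite ler_wpM2l // exprn_ge0.
have h4 : S ^+ 3 * 2 <= S ^+ 3 * lg.
  by rewrite ler_wpM2l ?exprn_ge0 //; move: lg_ge; lra.
have -> : 384 * cst * (S ^+ 3 * lg) = 192 * cst * (S ^+ 3 * lg + S ^+ 3 * lg).
  by move: cst (S ^+ 3 * lg) => c z; ring.
by rewrite ler_wpM2l ?mulr_ge0 // lerD // (le_trans h3).
Qed.

(** [343 = 7^3], from [Y <= 7 S] since [48 <= 7^2]. *)
Lemma card_le_good_bottom :
  @card_le R _ (fun t : int * (eis * eis) => (`|t.1| ^ 2 <= 24 * H)%N /\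
      good_triple H t.1 t.2.1 t.2.2) (324 * 343 * (S ^+ 3 * lg)).
Proof.
have [Y [Y_le lt_Y]] := isqrt_exists (48 * H).
have Y0 : (0 < Y)%N by rewrite lt0n; apply: contraTneq lt_Y => ->; rewrite -leqNgt muln_gt0.
apply: card_leW (card_le_bottom_triples _ _ _ Y0 lt_Y) _.
have YS : Y%:R <= 7 * S by exact: (nat_le_S _ _ 7 Y_le isT).
have hY : harm R Y <= lg by exact: (harm_le _ _ Y_le isT).
have -> : 324 * 343 * (S ^+ 3 * lg) = 324 * (7 * S) ^+ 3 * lg by ring.
rewrite ler_pM ?harm_ge0 ?mulr_ge0 ?exprn_ge0 // ler_wpM2l //.
by rewrite lerXn2r ?nnegrE ?mulr_ge0.
Qed.

(** Bounds the number of dyadic ranges; [ln 2 >= 1 / 2] because [ln (1 / 2) <= - 1 / 2]. *)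
Lemma trunc_log_le : (trunc_log 2 H).+1%:R <= 2 * lg.
Proof.
set k := trunc_log 2 H; have k_le : (2 ^ k <= H)%N by rewrite trunc_logP.
have ln2 : 1 / 2 <= ln 2 :> R.
  have := @le_ln1Dx R (- (1 / 2)); have -> : 1 + - (1 / 2) = 2^-1 :> R by lra.
  by rewrite lnV ?posrE // => /(_ ltac:(lra)); lra.
have : k%:R * ln 2 <= ln H%:R :> R.
  by rewrite mulr_natl -lnXn // ler_ln ?posrE ?exprn_gt0 ?ltr0n // -natrX ler_nat.
have : k%:R * (1 / 2) <= k%:R * ln 2 :> R by rewrite ler_wpM2l.
by rewrite -(natr1 k) /lg; move: (k%:R : R) (ln H%:R) (k%:R * ln 2) lnH_ge0 => x y z ? ? ?; lra.
Qed.

Lemma card_le_good :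
  @card_le R _ (fun t : int * (eis * eis) => good_triple H t.1 t.2.1 t.2.2)
    ((768 * cst + 324 * 343) * (S ^+ 3 * lg ^+ 2)).
Proof.
have S3 : 0 <= S ^+ 3 by rewrite exprn_ge0.
have c0 : 0 <= cst by rewrite /cst mulr_ge0.
have L0 : 0 <= S ^+ 3 * lg by rewrite mulr_ge0 //; move: lg_ge; lra.
apply: card_leW (_ : (\sum_(0 <= k < (trunc_log 2 H).+1) (384 * cst * (S ^+ 3 * lg)))
   + 324 * 343 * (S ^+ 3 * lg) <= _).
  apply: (@card_leU _ _ (fun t : int * (eis * eis) => (24 * H < `|t.1| ^ 2)%N /\
      good_triple H t.1 t.2.1 t.2.2) _ _ _ _ _ _ card_le_good_bottom).
    by move=> t gt; case: (leqP (`|t.1| ^ 2) (24 * H)) => ?; [right | left].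
  apply: (@card_le_sum _ _ (fun t : int * (eis * eis) => trunc_log 2 `|t.1|%N)).
    by move=> t [_ [aH _ _ _]]; rewrite ltnS leq_trunc_log.
  by move=> k _; apply: card_le_good_scale.
rewrite sumr_const_nat subn0 -[X in X + _ <= _]mulr_natl.
have h1 : (trunc_log 2 H).+1%:R * (384 * cst * (S ^+ 3 * lg)) <= 2 * lg * (384 * cst * (S ^+ 3 * lg)).
  by rewrite ler_wpM2r ?trunc_log_le // mulr_ge0 // mulr_ge0.
have h2 : 324 * 343 * (S ^+ 3 * lg) <= 324 * 343 * (S ^+ 3 * lg) * lg.
  by rewrite ler_peMr ?mulr_ge0 //; move: lg_ge; lra.
have -> : (768 * cst + 324 * 343) * (S ^+ 3 * lg ^+ 2) =
   2 * lg * (384 * cst * (S ^+ 3 * lg)) + 324 * 343 * (S ^+ 3 * lg) * lg.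
  by move: cst => c; ring.
exact: lerD.
Qed.

Lemma mem_int_box (x : int) : x \in int_box H -> (`|x| <= H)%N.
Proof. by case/mapP=> i; rewrite mem_iota => hi ->; lia. Qed.

Lemma int_box_uniq : uniq (int_box H).
Proof. by rewrite map_inj_uniq ?iota_uniq // => i j; lia. Qed.

Lemma count_nonS3_le :
  (count_nonS3 H)%:R <= (768 * cst + 324 * 343) * (S ^+ 3 * lg ^+ 2).
Proof.
rewrite /count_nonS3 -size_filter.
pose r (t : int * int * int) (u : int * (eis * eis)) :=
  [/\ t.1.1 = u.1, t.1.1 ^+ 2 - 3 * t.1.2 = eis_norm u.2.1 * eis_norm u.2.2
    & 2 * t.1.1 ^+ 3 - 9 * t.1.1 * t.1.2 + 27 * t.2 = eis_norm u.2.2 *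
       (2 * (u.2.1 ^+ 3 * u.2.2).1 - (u.2.1 ^+ 3 * u.2.2).2)].
apply: (@card_le_rel _ _ _ (0, (0, 0)) (fun t => [/\ (`|t.1.1| <= H)%N, (`|t.1.2| <= H)%N,
    (`|t.2| <= H)%N, irreducible_poly (cubic t.1.1 t.1.2 t.2)
    & ~ galois_group_isog_S3 (cubic t.1.1 t.1.2 t.2)]) _ r _ _ _ card_le_good).
- move=> [[a b] c] /= [aH bH cH irr nS3].
  have [w [m [gt [DI DJ]]]] := cubic_good_triple _ _ _ _ aH bH cH irr nS3.
  by exists (a, (w, m)).
- move=> [[a b] c] [[a' b'] c'] [a0 [w m]] [/= -> DI DJ] [/= -> DI' DJ'].
  have Eb : b = b' by move: DI DI' => /=; lia.
  by congr (_, _, _) => //; rewrite Eb in DJ; move: DJ DJ'; lia.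
- rewrite filter_uniq // allpairs_uniq ?int_box_uniq //.
  + by rewrite allpairs_uniq ?int_box_uniq // => -[? ?] [? ?].
  by move=> [? ?] [? ?] _ _ /= [-> ->].
move=> [[a b] c]; rewrite mem_filter => /andP[/asboolP[irr nS3]].
move=> /allpairsP[[ab' c'] [hab hc E]].
have [Eab Ec] : (a, b) = ab' /\ c = c' by case: E => <- <-.
move: (hab : ab' \in _) (hc : c' \in _); rewrite -Eab -Ec => {}hab {}hc.
move: hab => /allpairsP[[a' b'] [ha hb Eab']].
have [Ea Eb] : a = a' /\ b = b' by case: Eab' => <- <-.
move: (ha : a' \in _) (hb : b' \in _); rewrite -Ea -Eb => {}ha {}hb.
by split=> //; apply: mem_int_box.
Qed.

End Assembly.

Theorem theorem1p2 (R : realType) (eps : R) (heps : 0 < eps) :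
  exists (C : R) (H0 : nat), 0 < C /\
    forall H : nat, (H0 <= H)%N ->
      (count_nonS3 H)%:R <= C * (H%:R `^ (3 / 2 + eps)).
Proof.
pose K : R := 768 * (4320 * 156) + 324 * 343.
have K0 : 0 < K by rewrite /K; lra.
(* Chosen so that [48 + l <= D * (1 + eps * l / 2)] for [l = ln H]. As [exp t >= (1 + t / 2)^2],
   both logarithms are then absorbed by [H^eps]. *)
pose D : R := 48 + 2 / eps.
have D0 : 0 < D by rewrite /D addr_gt0 // divr_gt0.
exists (K * D ^+ 2), 1%N; split=> [|H H0]; first by rewrite mulr_gt0 // exprn_gt0.
apply: le_trans (count_nonS3_le R H H0) _; rewrite -/K -mulrA ler_pM2l //.
have h0 : 0 < H%:R :> R by rewrite ltr0n.
have h1 : H%:R != 0 :> R by rewrite gt_eqF.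
set l := ln H%:R; have l0 : 0 <= l by rewrite /l ln_ge0 // ler1n.
have -> : H%:R `^ (3 / 2 + eps) = Num.sqrt H%:R ^+ 3 * sequences.expR (eps * l) :> R.
  have -> : 3 / 2 + eps = 1 + (2^-1 + eps) :> R by lra.
  rewrite !powRD ?h1 ?implybT // powRr1 ?ltW // powR12_sqrt ?ltW // mulrA.
  rewrite {1}/powR (negPf h1) -/l; congr (_ * _).
  by rewrite exprS sqr_sqrtr ?ltW // mulrC.
rewrite [leRHS]mulrCA ler_wpM2l ?exprn_ge0 ?sqrtr_ge0 //.
have e2 : (1 + eps * l / 2) ^+ 2 <= sequences.expR (eps * l).
  have -> : eps * l = eps * l / 2 + eps * l / 2 by lra.
  have e1 := expR_ge1Dx (eps * l / 2).
  rewrite expRD expr2; have -> : (eps * l / 2 + eps * l / 2) / 2 = eps * l / 2 by lra.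
  have e0 : 0 <= 1 + eps * l / 2 by rewrite addr_ge0 // divr_ge0 // mulr_ge0 // ltW.
  exact: ler_pM.
apply: le_trans (_ : D ^+ 2 * (1 + eps * l / 2) ^+ 2 <= _); last first.
  by rewrite ler_wpM2l // exprn_ge0 // ltW.
have L0 : 0 <= 48 + l by rewrite addr_ge0.
suff le_L : 48 + l <= D * (1 + eps * l / 2).
  by rewrite -exprMn lerXn2r ?nnegrE // (le_trans L0).
have -> : D * (1 + eps * l / 2) = 48 + 24 * (eps * l) + 2 / eps + l.
  by rewrite /D; field; rewrite gt_eqF.
have : 0 <= eps * l by rewrite mulr_ge0 // ltW.
have : 0 <= 2 / eps by rewrite divr_ge0 // ltW.
by move: (eps * l) (2 / eps) => ? ?; lra.
Qed.
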